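(* Let $1<\alpha<2$, $\gamma>0$, $\tau>0$, $\mathrm{a}<\mathrm{b}$, let $M\ge 8$ be even, $h=(\mathrm{b}-\mathrm{a})/(M+1)$, $\mu=\gamma\tau/h^\alpha$, let $D\in\mathbb{R}^{M\times M}$ be diagonal with nonpositive diagonal entries, and let $\omega>0$. Let $$\theta=\frac{\left(1-\frac{1+\alpha}{5+\alpha/2}\right)^{5+\alpha/2}e^{1+\alpha}\Gamma(\alpha+1)\sin(\pi\alpha/2)}{\pi\alpha},\qquad \theta_0=\frac{\sqrt2\,e^{13/12}\Gamma(1+\alpha)\sin(\pi\alpha/2)}{\pi\alpha}.$$ Let $\epsilon$ satisfy $2^\alpha\mu\theta_0/(M-2)^\alpha<\epsilon\le\mu\theta_0$ and set $k_0=\lceil(\mu\theta_0/\epsilon)^{1/\alpha}\rceil+1$. Then there exist matrices $\mathcal{E}_{\omega c},\mathcal{F}_{\omega c}\in\mathbb{R}^{2M\times 2M}$ with $\mathrm{rank}(\mathcal{E}_{\omega c})=4k_0$, $$\|\mathcal{E}_{\omega c}\|_2\le\frac{M^{1/2}\mu}{\sqrt{1+\left[\omega+\frac{2^{\alpha+1}\gamma\tau\theta}{(\mathrm{b}-\mathrm{a})^\alpha}\right]^2}}\left[\frac{c_0}{2}-\frac{\theta}{(M-1/2)^\alpha}\right],\qquad \|\mathcal{F}_{\omega c}\|_2\le\frac{M^{1/2}\epsilon}{\sqrt{1+\left[\omega+\frac{2^{\alpha+1}\gamma\tau\theta}{(\mathrm{b}-\mathrm{a})^\alpha}\right]^2}},$$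 such that $\widetilde{\mathcal{F}}_\omega^{-1}\mathcal{F}_\omega=I+\mathcal{E}_{\omega c}+\mathcal{F}_{\omega c}$.
   Context: For $k\in\mathbb{Z}$, $c_k=(-1)^k\Gamma(\alpha+1)/[\Gamma(\alpha/2-k+1)\Gamma(\alpha/2+k+1)]$ ($\Gamma$ the gamma function, $1/\Gamma=0$ at poles); in particular $c_0=\Gamma(\alpha+1)/\Gamma(\alpha/2+1)^2$. $T\in\mathbb{R}^{M\times M}$ is the symmetric Toeplitz matrix with entries $T_{jk}=\mu c_{j-k}$. For even $M$, $C\in\mathbb{R}^{M\times M}$ is Strang's circulant approximation of $T$: the symmetric circulant matrix whose first row is $\mu(c_0,c_1,\dots,c_{M/2-1},0,c_{M/2-1},\dots,c_1)$, each subsequent row being the cyclic right shift of the previous one. With $I$ the identity of the appropriate size, define $$\mathcal{B}=\begin{bmatrix}-D&0\\0&-D\end{bmatrix},\quad \mathcal{H}=\begin{bmatrix}T&-I\\ I&T\end{bmatrix},\quad \mathcal{C}=\begin{bmatrix}C&-I\\ I&C\end{bmatrix},$$ $$\mathcal{F}_\omega=\tfrac{1}{2\omega}(\omega I+\mathcal{B})(\omega I+\mathcal{H}),\qquad \widetilde{\mathcal{F}}_\omega=\tfrac{1}{2\omega}(\omega I+\mathcal{B})(\omega I+\mathcal{C}).$$ $\|\cdot\|_2$ is the spectral norm. *)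

(* Defs.v *)
From mathcomp Require Import all_boot all_order all_algebra.
From mathcomp Require Import all_classical all_reals all_analysis.
Set Implicit Arguments. Unset Strict Implicit. Unset Printing Implicit Defensive.
Import Order.TTheory GRing.Theory Num.Theory.
Local Open Scope classical_set_scope.
Local Open Scope ring_scope.

Definition GammaPos (R : realType) (x : R) : R :=
  Rintegral (@lebesgue_measure R) `]0%R, +oo[
            (fun t : R => t `^ (x - 1) * expR (- t)).

(* Extension to x <= 0 via the recurrence Gamma(x) = Gamma(x+n)/(x(x+1)...(x+n-1)),
   with n = floor(-x)+1 so that x+n > 0.  At the poles (x a nonpositive integer)
   the product vanishes. *)
Definition Gamma (R : realType) (x : R) : R :=
  if 0 < x then GammaPos x
  else let n := (Num.truncn (- x)).+1 in
       GammaPos (x + n%:R) / \prod_(i < n) (x + i%:R).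

Definition invGamma (R : realType) (x : R) : R :=
  if (x <= 0) && (x \is a Num.int) then 0 else (Gamma x)^-1.

Definition coef (R : realType) (alpha : R) (k : int) : R :=
  (-1) ^+ `|k|%N * Gamma (alpha + 1)
  * invGamma (alpha / 2 - k%:~R + 1) * invGamma (alpha / 2 + k%:~R + 1).

Definition toepT (R : realType) (alpha mu : R) (M : nat) : 'M[R]_M :=
  \matrix_(j < M, k < M) (mu * coef alpha (j%:Z - k%:Z)).

(* Strang circulant: first row mu(c_0,...,c_{M/2-1},0,c_{M/2-1},...,c_1),
   row j is the cyclic right shift by j: entry (j,k) = mu * s((k - j) mod M). *)
Definition strang_first (R : realType) (alpha : R) (M m : nat) : R :=
  if (m < M %/ 2)%N then coef alpha m%:Z
  else if m == (M %/ 2)%N then 0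
  else coef alpha (M - m)%N%:Z.

Definition strangC (R : realType) (alpha mu : R) (M : nat) : 'M[R]_M :=
  \matrix_(j < M, k < M) (mu * strang_first alpha M ((k + M - j) %% M)%N).

Definition calB (R : realType) (M : nat) (D : 'M[R]_M) : 'M[R]_(M + M) :=
  block_mx (- D) 0 0 (- D).
Definition calH (R : realType) (M : nat) (T : 'M[R]_M) : 'M[R]_(M + M) :=
  block_mx T (- 1%:M) 1%:M T.

Definition calF (R : realType) (M : nat) (omega : R) (B H : 'M[R]_(M + M))
  : 'M[R]_(M + M) :=
  (2 * omega)^-1 *: ((omega%:M + B) *m (omega%:M + H)).

Definition vnorm2 (R : realType) (n : nat) (x : 'cV[R]_n) : R :=
  Num.sqrt (\sum_(i < n) x i 0 ^+ 2).
Definition specnorm (R : realType) (m n : nat) (A : 'M[R]_(m, n)) : R :=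
  sup [set vnorm2 (A *m x) | x in [set x : 'cV[R]_n | vnorm2 x = 1]].

(* Main.v *)
(* Write s = alpha/2 and c_k for the coefficients.  They satisfy
   (k+1+s) c_(k+1) = (k-s) c_k, hence c_k < 0 increases to 0 for k >= 1, and the
   tails telescope: with t_n = (n+s)(-c_n)/alpha one has t_n - t_(n+1) = -c_n
   and t_1 = c_0/2, so t_n plays the part of the sum of -c_k over k >= n and no
   infinite series is needed.  Since t_(n+1) = t_n (n-s)/(n+s), Bernoulli's
   inequality gives ((n-1)/n)^alpha <= (n-s)/(n+s) <= (n/(n+1))^alpha; thus
   t_n (n-1)^alpha increases, t_n n^alpha decreases, and comparing with n = 4 and
   n = 2 yields theta/(n+1/2)^alpha <= t_n (n >= 4) and
   t_n <= theta0/(n-2)^alpha (n >= 3).  The constants leave enough room for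
   2^(s-1) <= Gamma(1+s) <= 2^s/(1+s), pi >= 3 and
   2(1-s) <= sin(pi s) <= 4s(1-s) to replace the reflection formula.

   Now Ft^-1 F = I + (omega I + calH C)^-1 diag(T-C, T-C).  By diagonal
   dominance C >= 2 mu t_(M/2) >= L, where L is the term added to omega in den,
   and the skew coupling turns this into
   |(omega I + calH C) x|^2 >= (1 + (omega+L)^2) |x|^2.  The matrix T-C lives in
   two corner triangles, with entries of modulus at most -mu c_p where
   p = M - |j-k| <= M/2: the entries with p <= k0 form two nonsingular
   triangular blocks, of total rank 2 k0 and with row sums at most
   mu (c_0/2 - t_(k0+1)), and the remaining row sums are at most mu t_(k0+1). *)
Require Import Defs.
From mathcomp Require Import all_boot all_order all_algebra.
From mathcomp Require Import all_classical all_reals all_analysis.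
From mathcomp Require Import measurable_realfun ring lra zify.
Import Order.TTheory GRing.Theory Num.Theory.
Import numFieldNormedType.Exports.
Local Open Scope classical_set_scope.
Local Open Scope ring_scope.

(** * The Gamma integral *)

Section GammaFunction.
Context {R : realType}.
Implicit Types (x y t : R) (n : nat).
Notation mu := (@lebesgue_measure R).

Definition gammaf x t : R := t `^ (x - 1) * expR (- t).

(** Kept in the extended reals: [GammaPos] is its finite part, which would be 0 for a divergent
    integral, so finiteness has to be proved separately ([eGamma_fin_num]). *)
Definition eGamma x : \bar R := (\int[mu]_(t in `]0%R, +oo[) (gammaf x t)%:E)%E.

Lemma gammaf_ge0 x t : 0 <= gammaf x t.
Proof. by rewrite mulr_ge0 ?powR_ge0 ?expR_ge0. Qed.

Lemma measurable_gammaf x (A : set R) : measurable A ->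
  measurable_fun A (EFin \o gammaf x).
Proof.
move=> mA; apply/measurable_EFinP; apply: (measurable_funS measurableT) => //.
apply: measurable_funM; first exact: measurable_powR.
by apply: measurableT_comp => //; exact: measurable_expR.
Qed.

Lemma eGamma_ge0 x : (0 <= eGamma x)%E.
Proof. by apply: integral_ge0 => t _; rewrite lee_fin gammaf_ge0. Qed.

Lemma GammaPosE x : GammaPos x = fine (eGamma x).
Proof. by []. Qed.

(* [gammaf x] is singular at [0] when [x < 1], so both ends are cut off. *)
Definition cutoff n : set R := `[n.+2%:R^-1, n.+2%:R]%classic.

Lemma cutoff_bigcup : \bigcup_n cutoff n = `]0%R, +oo[%classic.
Proof.
apply/seteqP; split=> [t [n _]|t]; rewrite /cutoff/= !in_itv/= ?andbT.
  by case/andP => + _; apply: lt_le_trans; rewrite invr_gt0.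
move=> t0; pose m := (Num.truncn t + Num.truncn t^-1)%N.
have tm : t < (Num.truncn t).+1%:R by apply: truncnS_gt.
have tVm : t^-1 < (Num.truncn t^-1).+1%:R by apply: truncnS_gt.
exists m => //=; rewrite in_itv/=; apply/andP; split.
  rewrite -[leRHS]invrK lef_pV2 ?posrE ?invr_gt0//.
  by rewrite (le_trans (ltW tVm))// ler_nat /m; lia.
by rewrite (le_trans (ltW tm))// ler_nat /m; lia.
Qed.

(** Monotone convergence along the increasing sets [cutoff n]. *)
Lemma cvg_eGamma x :
  (\int[mu]_(t in cutoff n) (gammaf x t)%:E @[n --> \oo] --> eGamma x)%E.
Proof.
rewrite /eGamma -cutoff_bigcup; apply: ge0_nondecreasing_set_cvg_integral.
- move=> m n mn; apply/subsetPset => t; rewrite /cutoff/= !in_itv/= => /andP[a b].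
  apply/andP; split; last by rewrite (le_trans b)// ler_nat !ltnS.
  by apply: le_trans a; rewrite lef_pV2 ?posrE// ler_nat !ltnS.
- by move=> n; exact: measurable_itv.
- by move=> n; apply: measurable_gammaf; exact: measurable_itv.
- by move=> n t _; rewrite lee_fin gammaf_ge0.
Qed.


Lemma cutoff_lt n : n.+2%:R^-1 < n.+2%:R :> R.
Proof. by rewrite (@lt_trans _ _ 1)// ?invf_lt1// ltr1n. Qed.

Lemma derivable_ge_oo_LRcontinuous (F : R -> R) (a b : R) : a < b ->
  (forall t, a <= t -> derivable F t 1) -> derivable_oo_LRcontinuous F a b.
Proof.
move=> ab dF; split.
- by move=> t; rewrite in_itv/= => /andP[/ltW/dF].
- apply: cvg_at_right_filter; apply: differentiable_continuous.
  exact/derivable1_diffP/dF.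
- apply: cvg_at_left_filter; apply: differentiable_continuous.
  exact/derivable1_diffP/dF/ltW.
Qed.

(** Integration by parts of t^x against the primitive -e^(-t); the boundary terms are kept and shown
    to vanish in the limit by [cvg_gammaf_0] and [cvg_gammaf_y]. *)
Lemma integral_gammaf_cutoff x n : 0 < x ->
  (\int[mu]_(t in cutoff n) (gammaf (x + 1) t)%:E =
   (gammaf (x + 1) n.+2%:R^-1 - gammaf (x + 1) n.+2%:R)%:E +
   x%:E * \int[mu]_(t in cutoff n) (gammaf x t)%:E)%E.
Proof.
move=> x0; rewrite /cutoff; set a := n.+2%:R^-1; set b := n.+2%:R.
have a0 : 0 < a by rewrite invr_gt0.
have ab : a < b by exact: cutoff_lt.
have gt0 t : a <= t -> 0 < t by exact: lt_le_trans.
have dexp t : is_derive t 1 (fun t : R => - expR (- t)) (expR (- t)).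
  apply: is_derive_eq.
  by rewrite /= ?scaler1 ?mulN1r ?mulrN1 ?scaleN1r ?opprK.
have dpow t : a <= t -> is_derive t 1 (fun t : R => t `^ x) (x * t `^ (x - 1)).
  by move=> /gt0 t0; exact: is_derive1_powR.
have cexp : continuous (fun t : R => expR (- t)).
  by move=> t; apply: continuous_comp; [exact: continuousN|exact: continuous_expR].
transitivity (\int[mu]_(t in `[a, b]) (t `^ x * expR (- t))%:E)%E.
  by apply: eq_integral => t _; rewrite /gammaf addrK.
rewrite (@integration_by_parts R (fun t => t `^ x) (fun t => - expR (- t))
   (fun t => x * t `^ (x - 1)) (fun t => expR (- t)) a b ab).
- rewrite [X in (_ - X)%E](_ : _ =
               (- (x%:E * \int[mu]_(t in `[a, b]) (gammaf x t)%:E))%E).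
    by rewrite oppeK /gammaf addrK; congr (_%:E + _)%E; ring.
  rewrite -ge0_integralZl//; last 3 first.
  + by apply: measurable_gammaf.
  + by move=> t _; rewrite lee_fin gammaf_ge0.
  + by rewrite lee_fin ltW.
  rewrite -integral_ge0N; last first.
    by move=> t _; rewrite mule_ge0// lee_fin ?gammaf_ge0// ltW.
  by apply: eq_integral => t _; rewrite /gammaf -EFinM -EFinN mulrN mulrA.
- apply: derivable_within_continuous => t; rewrite in_itv/= => /andP[/gt0 t0 _].
  apply: derivableM; first exact: derivable_cst.
  by apply: derivable_powR; rewrite in_itv/= andbT.
- by apply: derivable_ge_oo_LRcontinuous => // t /dpow[].
- by move=> t; rewrite in_itv/= => /andP[/ltW/dpow[_ <-]] _; rewrite derive1E.
- exact: continuous_subspaceT.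
- by apply: derivable_ge_oo_LRcontinuous => // t _; have [] := dexp t.
- by move=> t _; rewrite derive1E; have [_ ->] := dexp t.
Qed.

Lemma cvg_gammaf_0 x : 1 < x -> gammaf x n.+2%:R^-1 @[n --> \oo] --> (0 : R).
Proof.
move=> x1.
have h : gammaf x t @[t --> 0^'+] --> (0 : R).
  rewrite -[X in _ --> X](mul0r (expR (- 0))); apply: cvgM.
    by apply: powR_cvg0; rewrite subr_gt0.
  apply: cvg_at_right_filter.
  by apply: continuous_comp; [exact: continuousN|exact: continuous_expR].
move/cvg_at_rightP : h; apply; split; first by move=> n; rewrite invr_gt0.
have := @cvg_harmonic R; rewrite -(cvg_shiftS (@harmonic R)); exact.
Qed.

(** The term of order [Num.truncn x] + 2 of the exponential series dominates t^x with a factor t to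
    spare. *)
Lemma gammaf_le_inv x t : 1 <= t ->
  gammaf (x + 1) t <= ((Num.truncn x).+2)`!%:R / t.
Proof.
move=> t1; have t0 : 0 < t by exact: lt_le_trans t1.
rewrite /gammaf addrK expRN -[leLHS]/(_ / _) ler_pdivrMr ?expR_gt0//.
rewrite mulrAC ler_pdivlMr//.
set N := (Num.truncn x).+1.
have : t `^ x <= t ^+ N.
  rewrite -powR_mulrn ?ler_powR// ?ltW//.
  by rewrite /N; exact: truncnS_gt.
move=> h; apply: (@le_trans _ _ (t ^+ N.+1)).
  by rewrite exprSr ler_wpM2r// ltW.
have := @expR_ge1Dxn R t N (ltW t0).
rewrite -(@ler_pM2l _ (N.+1)`!%:R) ?ltr0n ?fact_gt0//; apply: le_trans.
by rewrite mulrDr mulrCA mulfV ?mulr1 ?lerDr// pnatr_eq0 -lt0n fact_gt0.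
Qed.

Lemma cvg_gammaf_y x : gammaf (x + 1) n.+2%:R @[n --> \oo] --> (0 : R).
Proof.
apply: (@squeeze_cvgr _ _ _ _ (fun=> 0) (fun n => ((Num.truncn x).+2)`!%:R / n.+2%:R)).
- near=> n; rewrite gammaf_ge0/= gammaf_le_inv// ler1n//.
- exact: cvg_cst.
- rewrite -[X in _ --> X](mulr0 (((Num.truncn x).+2)`!%:R)); apply: cvgM.
    exact: cvg_cst.
  have := @cvg_harmonic R; rewrite -(cvg_shiftS (@harmonic R)); exact.
Unshelve. end_near. Qed.

(** Limit of [integral_gammaf_cutoff]. It holds in the extended reals, hence can be used to prove
    finiteness. *)
Lemma eGammaS x : 0 < x -> eGamma (x + 1) = (x%:E * eGamma x)%E.
Proof.
move=> x0; apply: (@cvg_unique _ (@ereal_hausdorff R) _ _ _ _ (cvg_eGamma (x + 1))).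
rewrite (_ : (fun n => _) = fun n =>
  ((gammaf (x + 1) n.+2%:R^-1 - gammaf (x + 1) n.+2%:R)%:E +
   x%:E * \int[mu]_(t in cutoff n) (gammaf x t)%:E)%E); last first.
  by apply/funext => n; rewrite integral_gammaf_cutoff.
change ((fun n =>
  ((gammaf (x + 1) n.+2%:R^-1 - gammaf (x + 1) n.+2%:R)%:E +
   x%:E * \int[mu]_(t in cutoff n) (gammaf x t)%:E)%E) @ \oo --> (x%:E * eGamma x)%E).
rewrite -[X in _ --> X]add0e; apply: cvgeD => //.
- apply: cvg_EFin; first exact: nearW.
  rewrite -[X in _ --> X](subr0 0); apply: cvgB; last exact: cvg_gammaf_y.
  by apply: cvg_gammaf_0; rewrite ltrDr.
- by apply: cvgeZl => //; exact: cvg_eGamma.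
Qed.

Lemma eGamma1 : eGamma 1 = 1%E.
Proof.
transitivity (\int[mu]_(t in `[0%R, +oo[) (expR (- t))%:E)%E.
  rewrite -integral_itv_obnd_cbnd; last first.
    by apply/measurable_EFinP; apply: measurableT_comp => //; exact: measurable_expR.
  by apply: eq_integral => t _; rewrite /gammaf subrr powRr0 mul1r.
have dexp t : is_derive t 1 (fun t : R => - expR (- t)) (expR (- t)).
  apply: is_derive_eq.
  by rewrite /= ?scaler1 ?mulN1r ?mulrN1 ?scaleN1r ?opprK.
have cexp : continuous (fun t : R => expR (- t)).
  by move=> t; apply: continuous_comp; [exact: continuousN|exact: continuous_expR].
rewrite (@ge0_continuous_FTC2y R _ (fun t => - expR (- t)) 0 0).
- by rewrite oppr0 expR0 -EFinB sub0r opprK.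
- by move=> t _; exact: expR_ge0.
- exact: continuous_subspaceT.
- by rewrite -[X in _ --> X]oppr0; apply: cvgN; exact: cvgr_expR.
- by move=> t _; have [] := dexp t.
- by apply: cvg_at_right_filter; apply: cvgN; exact: cexp.
- by move=> t _; rewrite derive1E; have [_ ->] := dexp t.
Qed.

Lemma eGamma_nat n : eGamma n.+1%:R = (n`!%:R)%:E.
Proof.
elim: n => [|n ih]; first by rewrite eGamma1.
by rewrite -[n.+2%:R]natr1 eGammaS// ih -EFinM -natrM -factS.
Qed.

Lemma eGamma_fin_num x : 0 < x -> eGamma x \is a fin_num.
Proof.
move=> x0; rewrite ge0_fin_numE ?eGamma_ge0//.
(* The recurrence transfers finiteness from x + 1 to x, so the singularity at 0 need not be
   integrated directly. *)
suff h y : 1 < y -> (eGamma y < +oo)%E.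
  have := h (x + 1); rewrite ltrDr eGammaS// => /(_ x0).
  have := eGamma_ge0 x; case: (eGamma x) => // [r|] _; first by rewrite !ltry.
  by rewrite gt0_muley ?lte_fin.
move=> y1; pose N := Num.truncn y.
(* With N the integer part of y, t^(y-1) is at most t^N for t >= 1 and at most 1 for t < 1; both
   majorants have factorial integrals. *)
have : (eGamma y <= \int[mu]_(t in `]0%R, +oo[)
    ((gammaf 1 t)%:E + (gammaf N.+1%:R t)%:E))%E.
  apply: ge0_le_integral => //.
  - by move=> t _; rewrite lee_fin gammaf_ge0.
  - exact: measurable_gammaf.
  - by apply: emeasurable_funD; exact: measurable_gammaf.
  move=> t; rewrite /= in_itv/= andbT => t0; rewrite -EFinD lee_fin /gammaf.
  rewrite -mulrDl ler_wpM2r ?expR_ge0// subrr powRr0.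
  have [t1|t1] := leP 1 t.
    rewrite ler_wpDl// ler_powR// lerD2r; exact: ltW (truncnS_gt _).
  rewrite ler_wpDr ?powR_ge0//.
  rewrite -[leRHS](powRr0 t); apply: ger_powR; first by rewrite t0 ltW.
  by rewrite subr_ge0 ltW.
move/le_lt_trans; apply.
rewrite ge0_integralD//; last 4 first.
- by move=> t _; rewrite lee_fin gammaf_ge0.
- exact: measurable_gammaf.
- by move=> t _; rewrite lee_fin gammaf_ge0.
- exact: measurable_gammaf.
by rewrite -!/(eGamma _) eGamma1 eGamma_nat -EFinD ltry.
Qed.

Lemma eGammaE x : 0 < x -> eGamma x = (GammaPos x)%:E.
Proof. by move=> x0; rewrite GammaPosE fineK ?eGamma_fin_num. Qed.

Lemma GammaPosS x : 0 < x -> GammaPos (x + 1) = x * GammaPos x.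
Proof.
move=> x0; apply: EFin_inj; rewrite EFinM -!eGammaE ?eGammaS//.
by rewrite addr_gt0.
Qed.

Lemma GammaPos_nat n : GammaPos n.+1%:R = n`!%:R :> R.
Proof. by apply: EFin_inj; rewrite -eGammaE// eGamma_nat. Qed.


(** Transfers a pointwise inequality between integrands to values of Gamma; the two tangent-line
    bounds below are instances. *)
Lemma le_GammaPos_lincomb x y z (A B C : R) : 0 < x -> 0 < y -> 0 < z ->
    0 <= A -> 0 <= B -> 0 <= C ->
    (forall t, 0 < t -> A * gammaf x t <= B * gammaf y t + C * gammaf z t) ->
  A * GammaPos x <= B * GammaPos y + C * GammaPos z.
Proof.
move=> x0 y0 z0 A0 B0 C0 h.
rewrite -lee_fin EFinD (EFinM A) (EFinM B) (EFinM C).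
rewrite -(eGammaE x)// -(eGammaE y)// -(eGammaE z)//.
rewrite /eGamma -!ge0_integralZl_EFin//; try by
  [exact: measurable_gammaf|move=> t _; rewrite lee_fin gammaf_ge0].
have mZ (D : set R) (r w : R) : measurable D ->
    measurable_fun D (fun t => r%:E * (gammaf w t)%:E)%E.
  by move=> mD; apply: emeasurable_funM => //; exact: measurable_gammaf.
rewrite -ge0_integralD//; try by
  [apply: mZ|move=> t _; rewrite mule_ge0// lee_fin ?gammaf_ge0].
apply: ge0_le_integral => //.
- by move=> t _; rewrite mule_ge0// lee_fin ?gammaf_ge0.
- by apply: mZ.
- by apply: emeasurable_funD; apply: mZ.
by move=> t; rewrite /= in_itv/= andbT => t0; rewrite -!EFinM -EFinD lee_fin h.
Qed.

(** Convexity of [expR] between ln u and 0, with weights s and 1 - s. *)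
Lemma powR_bernoulli (s u : R) : 0 <= s <= 1 -> 0 < u -> u `^ s <= 1 + s * (u - 1).
Proof.
move=> /andP[s0 s1] u0.
have := @convex_expR R (Itv01 s0 s1) (ln u) 0.
rewrite !convRE/= lnK ?posrE// expR0 mulr0 addr0 mulr1 /powR gt_eqF//.
by move/le_trans; apply; rewrite /unstable.onem le_eqVlt; apply/orP; left; apply/eqP; ring.
Qed.

(** Follows from [powR_bernoulli] and (1 - y)(1 + y) <= 1 with y = s (u - 1). *)
Lemma powR_bernoulliN (s u : R) : 0 <= s <= 1 -> 0 < u -> 1 - s * (u - 1) <= u `^ (- s).
Proof.
move=> s01 u0; have h := powR_bernoulli s u s01 u0; rewrite powRN.
have p0 : 0 < u `^ s by rewrite powR_gt0.
rewrite -[leRHS]mul1r ler_pdivlMr//.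
have [n0|n0] := leP (1 - s * (u - 1)) 0.
  by apply: (@le_trans _ _ 0) => //; rewrite mulr_le0_ge0// ltW.
apply: (@le_trans _ _ ((1 - s * (u - 1)) * (1 + s * (u - 1)))).
  by rewrite ler_wpM2l// ltW.
by have := sqr_ge0 (s * (u - 1)); lra.
Qed.

Lemma gammaf_nat n t : 0 <= t -> gammaf n.+1%:R t = t ^+ n * expR (- t).
Proof. by move=> t0; rewrite /gammaf -natr1 addrK powR_mulrn. Qed.

(* Integrates the tangent inequality at [t = 2] for the convex [t `^ (s - 1)]. *)
Lemma GammaPos1D_ge (s : R) : 0 <= s <= 1 -> 2 `^ (s - 1) <= GammaPos (1 + s).
Proof.
move=> s01; have /andP[s0 s1] := s01.
have p0 : 0 < 2 `^ (s - 1) :> R by rewrite powR_gt0.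
have := le_GammaPos_lincomb 2%:R (1 + s) 3%:R (2 `^ (s - 1) * (2 - s)) 1
  (2 `^ (s - 1) * ((1 - s) / 2)).
rewrite !GammaPos_nat !mulr1 mul1r => h; suff : 2 `^ (s - 1) * (2 - s) <=
   GammaPos (1 + s) + 2 `^ (s - 1) * ((1 - s) / 2) * 2.
  by lra.
apply: h => //; rewrite ?mulr_ge0 ?(ltW p0)//; try lra.
move=> t t0; rewrite !gammaf_nat ?(ltW t0)// mul1r /gammaf.
have e0 := expR_gt0 (- t).
rewrite !mulrA -mulrDl ler_pM2r// (_ : 1 + s - 1 = s); last by ring.
have -> : t `^ s = t * (2 `^ (s - 1) * (t / 2) `^ (- (1 - s))).
  rewrite opprB -powRM ?divr_ge0 ?ltW// [2 * _]mulrCA mulfV ?mulr1//.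
  rewrite -[t in t * _]powRr1 ?ltW// -powRD ?(gt_eqF t0) ?implybT//.
  by congr (_ `^ _); ring.
have := @powR_bernoulliN (1 - s) (t / 2).
rewrite subr_ge0 s1 gerBl s0 divr_gt0// => /(_ isT isT) hb.
have := ler_wpM2l (ltW (mulr_gt0 t0 p0)) hb.
by rewrite ?expr1 ?expr2; lra.
Qed.

(* Integrates the tangent inequality at [t = 2] for the concave [t `^ s], against
   [t * expR (- t)]. *)
Lemma GammaPos1D_le (s : R) : 0 <= s <= 1 -> GammaPos (1 + s) <= 2 `^ s / (1 + s).
Proof.
move=> s01; have /andP[s0 s1] := s01.
have p0 : 0 < 2 `^ s :> R by rewrite powR_gt0.
rewrite ler_pdivlMr; last lra.
rewrite mulrC -GammaPosS; last lra.
have := le_GammaPos_lincomb (1 + s + 1) 2%:R 3%:R 1 (2 `^ s * (1 - s)) (2 `^ s * (s / 2)).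
rewrite !GammaPos_nat !mulr1 mul1r => h; suff : GammaPos (1 + s + 1) <=
   2 `^ s * (1 - s) + 2 `^ s * (s / 2) * 2.
  by lra.
apply: h => //; rewrite ?mulr_ge0 ?(ltW p0)//; try lra.
move=> t t0; rewrite !gammaf_nat ?(ltW t0)// mul1r /gammaf addrK.
have e0 := expR_gt0 (- t).
rewrite !mulrA -mulrDl ler_pM2r//.
have -> : t `^ (1 + s) = t * (2 `^ s * (t / 2) `^ s).
  rewrite -powRM ?divr_ge0 ?ltW// mulrCA mulfV ?mulr1// powRD ?powRr1 ?ltW//.
  by rewrite (gt_eqF t0) implybT.
have := @powR_bernoulli s (t / 2) s01; rewrite divr_gt0// => /(_ isT) hb.
have := ler_wpM2l (ltW (mulr_gt0 t0 p0)) hb.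
by rewrite ?expr1 ?expr2; lra.
Qed.

End GammaFunction.

(** * The coefficients and their tails *)

Section Coefficients.
Set Implicit Arguments.
Unset Strict Implicit.
Context {R : realType}.
Implicit Types (x alpha s : R) (n k : nat).

(** The definition shifts a nonpositive x just past 0. The cases are x > 0, -1 < x < 0 and x <= -1;
    in the last one the shifts of x and x + 1 differ by one. *)
Lemma GammaS x : (0 < x) || (x \isn't a Num.int) -> Gamma (x + 1) = x * Gamma x.
Proof.
have [x0 _|x0] := ltP 0 x.
  by rewrite /Gamma x0 addr_gt0// GammaPosS.
rewrite /= => xint.
have xn0 : x != 0 by apply: contraNneq xint => ->; exact: rpred0.
have xlt0 : x < 0 by rewrite lt_neqAle xn0.
have [x1|x1] := ltP 0 (x + 1).
  rewrite /Gamma x1 ltNge x0/=.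
  rewrite (_ : Num.truncn (- x) = 0%N); last first.
    by apply/eqP; rewrite -leqn0 -ltnS truncn_lt_nat; lra.
  by rewrite big_ord_recl big_ord0 addr0 mulr1 mulrCA mulfV ?mulr1.
rewrite /Gamma !ltNge x0 x1/=.
have -> : Num.truncn (- x) = (Num.truncn (- (x + 1))).+1.
  apply: truncn_def.
  have := @truncn_itv R (- (x + 1)).
  rewrite oppr_ge0 x1 => /(_ isT)/andP[h1 h2].
  by rewrite -[_.+1%:R]natr1 -[_.+2%:R]natr1; apply/andP; split; lra.
set m := Num.truncn _.
rewrite [in RHS]big_ord_recl addr0 invfM mulrCA [x * _]mulrA mulfV// mul1r.
rewrite -[in RHS]natr1 [m.+1%:R + 1]addrC addrA; congr (_ / _).
by apply: eq_bigr => i _; rewrite /= /bump/= add1n -[in RHS]natr1 [i%:R + 1]addrC addrA.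
Qed.

Lemma invGammaS x : (0 < x) || (x \isn't a Num.int) ->
  invGamma x = x * invGamma (x + 1).
Proof.
move=> h; rewrite /invGamma.
have xn0 : x != 0.
  by case/orP: h => [/gt_eqF->//|]; apply: contraNneq => ->; exact: rpred0.
rewrite (_ : (x <= 0) && _ = false); last first.
  by rewrite leNgt; case/orP: h => [->//|/negPf->]; rewrite andbF.
rewrite (_ : (x + 1 <= 0) && _ = false); last first.
  case/orP: h => [h|h]; first by rewrite leNgt addr_gt0.
  apply/negP => /andP[_ xint]; move/negP: h; apply.
  by rewrite -(addrK 1 x) rpredB// rpred1.
by rewrite GammaS// invfM mulrA mulfV// mul1r.
Qed.

Lemma coef_opp alpha (z : int) : coef alpha (- z) = coef alpha z.
Proof. by rewrite /coef abszN mulrAC intrN opprK. Qed.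

(** [invGammaS] applies to both factors: alpha/2 + k + 1 is positive, and alpha/2 - k is not an
    integer because 0 < alpha/2 < 1. *)
Lemma coefS alpha k : 0 < alpha < 2 ->
  (k.+1%:R + alpha / 2) * coef alpha k.+1 = (k%:R - alpha / 2) * coef alpha k.
Proof.
move=> /andP[a0 a2]; rewrite /coef !absz_nat.
rewrite -!pmulrn.
have h1 : invGamma (alpha / 2 - k.+1%:R + 1) =
    (alpha / 2 - k%:R) * invGamma (alpha / 2 - k%:R + 1).
  rewrite -[k.+1%:R]natr1 opprD addrA addrNK; apply: invGammaS.
  apply/orP; right; apply/negP => h.
  have : alpha / 2 \is a Num.int.
    by rewrite -(addrNK k%:R (alpha / 2)) rpredD// rpred_nat.
  move/intrP => [z hz].
  have : (0 : R) < z%:~R by rewrite -hz; lra.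
  have : z%:~R < (1 : R) by rewrite -hz; lra.
  by rewrite ltrz1 ltr0z; lia.
have h2 : invGamma (alpha / 2 + k%:R + 1) =
    (alpha / 2 + k%:R + 1) * invGamma (alpha / 2 + k.+1%:R + 1).
  rewrite -[k.+1%:R]natr1 [alpha / 2 + (k%:R + 1)]addrA.
  apply: invGammaS; apply/orP; left.
  by have := ler0n R k; lra.
rewrite h1 h2 exprS -natr1; ring.
Qed.

Lemma coef0E alpha : 0 < alpha ->
  coef alpha 0 = Gamma (alpha + 1) / Gamma (alpha / 2 + 1) ^+ 2.
Proof.
move=> a0; rewrite /coef absz0 expr0 mul1r subr0 addr0 /invGamma.
by rewrite leNgt addr_gt0 ?divr_gt0//= -mulrA -invfM expr2.
Qed.

(* The sum of [- coef alpha k] over [k >= n], in closed form. *)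
Definition ctail alpha n : R := (n%:R + alpha / 2) * - coef alpha n / alpha.

Lemma ctailB alpha n : 0 < alpha < 2 ->
  ctail alpha n - ctail alpha n.+1 = - coef alpha n.
Proof.
move=> a02; have /andP[a0 _] := a02.
rewrite /ctail !mulrN coefS//; field.
by rewrite gt_eqF.
Qed.

Lemma ctailS alpha n : 0 < alpha < 2 ->
  ctail alpha n.+1 = ctail alpha n * ((n%:R - alpha / 2) / (n%:R + alpha / 2)).
Proof.
move=> a02; have /andP[a0 _] := a02.
have n0 := ler0n R n.
by rewrite /ctail !mulrN coefS//; field; rewrite !gt_eqF//; lra.
Qed.

(** At index 0 the ratio in [ctailS] is -1, and [ctail alpha 0] is -c_0/2. *)
Lemma ctail1 alpha : 0 < alpha < 2 -> ctail alpha 1 = coef alpha 0 / 2.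
Proof.
move=> a02; have /andP[a0 _] := a02.
by rewrite ctailS// /ctail; field; rewrite gt_eqF.
Qed.

(** Positivity on [1, 2] comes from [GammaPos1D_ge]; the recurrence carries it upwards to all y >=
    1, then down once to every x > 0. *)
Lemma GammaPos_gt0 x : 0 < x -> 0 < GammaPos x.
Proof.
have h (y : R) : 1 <= y <= 2 -> 0 < GammaPos y.
  move=> y12; have := @GammaPos1D_ge R (y - 1).
  rewrite addrCA subrr addr0 => h; apply: lt_le_trans (h _); last by lra.
  by rewrite powR_gt0.
have hn m (y : R) : 1 <= y <= m.+2%:R -> 0 < GammaPos y.
  elim: m y => [|m ih] y; first exact: h.
  move=> /andP[y1]; rewrite -natr1 => ym.
  have [y2|y2] := leP y 2; first by apply: h; rewrite y1.
  rewrite -(subrK 1 y) GammaPosS ?mulr_gt0 ?ih//; lra.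
move=> x0; have : 0 < GammaPos (x + 1).
  apply: (hn (Num.truncn x)); rewrite -natr1 lerD2r lerDr ltW//=.
  exact: ltW (truncnS_gt x).
by rewrite GammaPosS// pmulr_rgt0.
Qed.

Lemma coef0_gt0 alpha : 0 < alpha -> 0 < coef alpha 0.
Proof.
move=> a0; rewrite coef0E// /Gamma !ifT ?addr_gt0 ?divr_gt0// ?exprn_gt0//;
  by rewrite GammaPos_gt0// addr_gt0 ?divr_gt0.
Qed.

(** In [coefS] the factor k - alpha/2 is negative at k = 0 and positive afterwards, so the sign
    changes only once. *)
Lemma coef_lt0 alpha k : 0 < alpha < 2 -> coef alpha k.+1 < 0.
Proof.
move=> a02; have /andP[a0 a2] := a02.
elim: k => [|k ih].
  have := coefS 0 a02; have := coef0_gt0 a0 => c0 h.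
  have : (1 + alpha / 2) * coef alpha 1 < 0.
    by rewrite h sub0r mulNr oppr_lt0 mulr_gt0// divr_gt0.
  by rewrite pmulr_rlt0// addr_gt0// divr_gt0.
have k0 := ler0n R k.
have : (k.+2%:R + alpha / 2) * coef alpha k.+2 < 0.
  by rewrite coefS// pmulr_rlt0// -natr1; lra.
by rewrite pmulr_rlt0// -natr1 -natr1; lra.
Qed.

Lemma coef_increasing alpha m n : 0 < alpha < 2 -> (0 < m < n)%N ->
  coef alpha m < coef alpha n.
Proof.
move=> a02 /andP[m0]; have /andP[a0 a2] := a02.
case: m m0 => // m _.
elim: n => // n ih; rewrite ltnS leq_eqVlt => hmn.
suff h : coef alpha n < coef alpha n.+1.
  by case/predU1P: hmn => [->//|/ih/lt_trans]; apply.
case: n ih hmn => // n _ _.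
have c := coef_lt0 n a02; have n0 := ler0n R n.
rewrite -(@ltr_pM2l _ (n.+2%:R + alpha / 2)); last by rewrite -natr1 -natr1; lra.
rewrite coefS// ltr_nM2r// -[n.+2%:R]natr1; lra.
Qed.

Lemma ctail_gt0 alpha n : 0 < alpha < 2 -> 0 < ctail alpha n.+1.
Proof.
move=> a02; have /andP[a0 a2] := a02.
rewrite /ctail divr_gt0// mulr_gt0 ?oppr_gt0 ?coef_lt0//.
by rewrite addr_gt0// divr_gt0.
Qed.

Lemma sum_coef alpha m n : 0 < alpha < 2 -> (m <= n)%N ->
  \sum_(m <= k < n) - coef alpha k = ctail alpha m - ctail alpha n.
Proof.
move=> a02 mn; rewrite (eq_bigr (fun k => - (ctail alpha k.+1 - ctail alpha k))).
  by rewrite sumrN telescope_sumr// opprB.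
by move=> k _; rewrite opprB ctailB.
Qed.

Lemma ctail_decreasing alpha m n : 0 < alpha < 2 -> (0 < m <= n)%N ->
  ctail alpha n <= ctail alpha m.
Proof.
move=> a02 /andP[m0 mn]; rewrite -subr_ge0 -sum_coef// big_nat sumr_ge0// => k.
move=> /andP[mk _]; rewrite oppr_ge0 ltW//.
by case: k mk => [|k _]; [lia|exact: coef_lt0].
Qed.

End Coefficients.

(** * Elementary bounds *)

Section TrigBounds.
Context {R : realType}.
Implicit Types (t w x s : R).
Set Implicit Arguments.
Unset Strict Implicit.

(* The mean value theorem on [0, t w] and on [t w, w], [cos] being decreasing. *)
Lemma sin_chord t w : 0 <= t <= 1 -> 0 <= w <= pi / 2 -> t * sin w <= sin (t * w).
Proof.
move=> /andP[t0 t1] /andP[w0 w1].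
have tw : 0 <= t * w by rewrite mulr_ge0.
have tw1 : t * w <= w by rewrite ler_piMl.
have dsin x : is_derive x 1 (@sin R) (cos x) by exact: is_derive_sin.
have csin (A : set R) : {within A, continuous (@sin R)}.
  by apply: continuous_subspaceT; exact: continuous_sin.
have [c1 c1I e1] := @MVT_segment R sin cos 0 (t * w) tw (fun x _ => dsin x) (csin _).
have [c2 c2I e2] := @MVT_segment R sin cos (t * w) w tw1 (fun x _ => dsin x) (csin _).
move: c1I c2I; rewrite !in_itv/= => /andP[c10 c11] /andP[c20 c21].
rewrite sin0 !subr0 in e1.
have : cos c2 <= cos c1.
  have pi0 := pi_gt0 R.
  have := @ltr_cos R; move=> /(_ c1 c2).
  rewrite !in_itv/=; have [->|c12] := eqVneq c1 c2; first by [].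
  move=> h; rewrite ltW// h//.
  + by rewrite lt_neqAle c12 (le_trans c11).
  + by apply/andP; split; lra.
  + by apply/andP; split; lra.
move=> hc; have sw : sin w = cos c2 * (w - t * w) + cos c1 * (t * w) by lra.
rewrite e1 sw.
have : 0 <= (cos c1 - cos c2) * (t * w * (1 - t)).
  by rewrite mulr_ge0 ?subr_ge0// mulr_ge0// subr_ge0.
lra.
Qed.

Lemma sin_le x : 0 <= x -> sin x <= x.
Proof.
move=> x0; have [c _] := @MVT_segment R sin cos 0 x x0
  (fun x _ => is_derive_sin x) (continuous_subspaceT (@continuous_sin R)).
rewrite sin0 !subr0 => ->; rewrite ler_piMl//; exact: cos_le1.
Qed.

(** The triple-angle formula at pi/6 gives 3y - 4y^3 = 1 for y = sin(pi/6), that is (y + 1)(2y -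
    1)^2 = 0, so y = 1/2; then sin x <= x gives 1/2 <= pi/6. *)
Lemma pi_ge3 : 3 <= pi :> R.
Proof.
have pi0 := pi_gt0 R.
pose y : R := sin (pi / 6).
have y0 : 0 < y by apply: sin_gt0_pihalf; apply/andP; split; lra.
have y3 : 3 * y - 4 * y ^+ 3 = 1.
  transitivity (sin (pi / 2 : R)); last exact: sin_pihalf.
  rewrite (_ : pi / 2 = (pi / 6) *+ 2 + pi / 6); last first.
    by rewrite mulr2n; field.
  rewrite sinD sin_mulr2n cos_mulr2n -/y.
  have := cos2Dsin2 (pi / 6 : R); rewrite -/y => h.
  set c := cos _ in h *.
  have -> : c ^+ 2 = 1 - y ^+ 2 by rewrite -h; ring.
  have e : c * c = 1 - y ^+ 2 by rewrite -expr2 -h; ring.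
  have -> : c * y *+ 2 * c = (c * c) * y *+ 2 by ring.
  rewrite e; ring.
have : (y + 1) * (2 * y - 1) ^+ 2 = 0 by move: y3; lra.
move=> /eqP; rewrite mulf_eq0 gt_eqF ?addr_gt0//= sqrf_eq0 => /eqP yE.
have : y <= pi / 6 by apply: sin_le; rewrite divr_ge0// ltW.
lra.
Qed.

Lemma sin_piquarter_sqr : sin (pi / 4) ^+ 2 = 1 / 2 :> R.
Proof.
have := cos_mulr2n (pi / 4 : R).
rewrite -[(pi / 4) *+ 2]mulr_natr (_ : pi / 4 * 2%:R = pi / 2); last by field.
rewrite cos_pihalf cos2sin2 => h; lra.
Qed.

(* For [s = (1 + z) / 2] this is [sin (pi s) = 1 - 2 sin^2 (pi z / 4)] together
   with the chord bound on [0, pi/4]. *)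
Lemma sin_pi_le s : 1 / 2 <= s <= 1 -> sin (pi * s) <= 4 * s * (1 - s).
Proof.
move=> /andP[s0 s1]; have pi0 := pi_gt0 R.
set z := 2 * s - 1.
have -> : pi * s = (pi / 4 * z) *+ 2 + pi / 2 by rewrite mulr2n /z; field.
rewrite sinDpihalf cos_mulr2n cos2sin2.
have := @sin_chord z (pi / 4); rewrite [z * (pi / 4)]mulrC => h.
have {h} : z * sin (pi / 4) <= sin (pi / 4 * z).
  by apply: h; apply/andP; split; rewrite /z; lra.
have z0 : 0 <= z by rewrite /z; lra.
have sp : 0 <= sin (pi / 4 : R) by apply: sin_ge0_pi; apply/andP; split; lra.
move=> h; have : (z * sin (pi / 4)) ^+ 2 <= sin (pi / 4 * z) ^+ 2.
  by rewrite ler_pXn2r// ?nnegrE ?mulr_ge0// (le_trans _ h)// mulr_ge0.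
rewrite exprMn sin_piquarter_sqr /z; lra.
Qed.

(** Chord bound on [0, pi/2] at pi (1 - s), whose sine is that of pi s. *)
Lemma sin_pi_ge s : 1 / 2 <= s <= 1 -> 2 * (1 - s) <= sin (pi * s).
Proof.
move=> /andP[s0 s1]; have pi0 := pi_gt0 R.
have := @sin_chord (2 * (1 - s)) (pi / 2).
rewrite sin_pihalf mulr1 => h; apply: le_trans (h _ _) _; [lra..|].
rewrite -[leRHS]opprK -sinN -sinDpi le_eqVlt; apply/orP; left; apply/eqP.
by congr sin; field.
Qed.

End TrigBounds.

(** * Bounds for the exponential and for powers of ratios *)

Section ExpBounds.
Context {R : realType}.
Implicit Types (x q s : R).
Set Implicit Arguments.
Unset Strict Implicit.

Lemma expR_ge_quadratic q : 0 <= q -> 1 + q + q ^+ 2 / 2 <= expR q.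
Proof.
move=> q0; pose f x : R := expR x - (x + x * x * 2^-1).
have df x : is_derive x 1 f (expR x - (1 + x)).
  apply: is_derive_eq.
  by rewrite ?derive_val /GRing.scale/= ?mulr1 ?mulr0 ?addr0; field.
have cf : {within `[0, q], continuous f}.
  by apply: derivable_within_continuous => t _; have [] := df t.
have [c cI] := @MVT_segment R f (fun x => expR x - (1 + x)) 0 q q0 (fun x _ => df x) cf.
rewrite /f expR0 !mul0r !addr0 !subr0 => e.
have : 0 <= (expR c - (1 + c)) * q by rewrite mulr_ge0// subr_ge0 expR_ge1Dx.
rewrite -e expr2; lra.
Qed.

(** The function (1 - t) e^(t + t^2/2) has derivative -t^2 e^(t + t^2/2), so it stays below its
    value 1 at t = 0. *)
Lemma onem_expR_le x : 0 <= x < 1 -> (1 - x) * expR x <= expR (- (x ^+ 2 / 2)).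
Proof.
move=> /andP[x0 x1]; pose f t : R := (1 - t) * expR (t + t * t * 2^-1).
pose f' t : R := - (t * t) * expR (t + t * t * 2^-1).
have df (t : R) : is_derive t 1 f (f' t).
  apply: is_derive_eq.
  by rewrite /f' ?derive_val /GRing.scale/= ?mulr1 ?mulr0 ?addr0; field.
have cf : {within `[0, x], continuous f}.
  by apply: derivable_within_continuous => t _; have [] := df t.
have [c cI] := @MVT_segment R f f' 0 x x0 (fun t _ => df t) cf.
rewrite /f !mul0r !addr0 expR0 !subr0 mulr1 => e.
have h : f' c * x <= 0.
  by rewrite mulr_le0_ge0// /f' mulNr oppr_le0 mulr_ge0 ?expR_ge0// -expr2 sqr_ge0.
rewrite expRN -[leRHS]mul1r ler_pdivlMr ?expR_gt0// -mulrA -expRD.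
rewrite expr2; lra.
Qed.

Lemma powRV_sqr (r s : R) : 0 < r -> r^-1 `^ (2 * s) = (r `^ s) ^- 2.
Proof.
move=> r0; rewrite -powR_inv1 ?ltW// -powRrM mulN1r powRN mulrC powRrM.
by rewrite powR_mulrn// powR_ge0.
Qed.

(** Bernoulli gives ((n+1)/n)^s <= (n+s)/n; square, invert, and use (n-s)(n+s) <= n^2. *)
Lemma powR_ratio_le s n : 0 <= s <= 1 -> (0 < n)%N ->
  (n%:R - s) / (n%:R + s) <= (n%:R / n.+1%:R) `^ (2 * s) :> R.
Proof.
move=> s01 n0; have /andP[s0 s1] := s01.
have n1 : 1 <= n%:R :> R by rewrite ler1n.
have h : (n.+1%:R / n%:R) `^ s <= (n%:R + s) / n%:R :> R.
  apply: le_trans (powR_bernoulli _ _ s01 _) _; first by rewrite divr_gt0 ?ltr0n.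
  rewrite -natr1 le_eqVlt; apply/orP; left; apply/eqP; field.
  by rewrite gt_eqF//; lra.
have p0 : 0 < (n.+1%:R / n%:R) `^ s :> R by rewrite powR_gt0// divr_gt0 ?ltr0n.
have ns : 0 < n%:R + s by lra.
rewrite -[n%:R / _]invf_div powRV_sqr ?divr_gt0 ?ltr0n//.
apply: (@le_trans _ _ (((n%:R + s) / n%:R) ^- 2)).
  rewrite expr_div_n invf_div ler_pdivrMr// mulrAC ler_pdivlMr ?exprn_gt0//.
  rewrite -subr_ge0 [leRHS](_ : _ = s ^+ 2 * (n%:R + s)); last by ring.
  by rewrite mulr_ge0 ?sqr_ge0// ltW.
rewrite lef_pV2 ?posrE ?exprn_gt0 ?divr_gt0 ?ltr0n//.
by rewrite ler_pXn2r// nnegrE ltW// divr_gt0 ?ltr0n.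
Qed.

(** With N = n + 1, Bernoulli gives ((N-1)/N)^s <= (N-s)/N; square and use (N-s)(N+s) <= N^2. *)
Lemma powR_ratio_ge s n : 0 <= s <= 1 -> (0 < n)%N ->
  (n%:R / n.+1%:R) `^ (2 * s) <= (n.+1%:R - s) / (n.+1%:R + s) :> R.
Proof.
move=> s01 n0; have /andP[s0 s1] := s01.
have n1 : 1 <= n%:R :> R by rewrite ler1n.
have h : (n%:R / n.+1%:R) `^ s <= (n.+1%:R - s) / n.+1%:R :> R.
  apply: le_trans (powR_bernoulli _ _ s01 _) _; first by rewrite divr_gt0 ?ltr0n.
  rewrite -natr1 le_eqVlt; apply/orP; left; apply/eqP; field.
  by rewrite gt_eqF//; lra.
rewrite [2 * s]mulrC powRrM powR_mulrn ?powR_ge0//.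
have N0 : 0 < n.+1%:R :> R by rewrite ltr0n.
have Ns : 0 <= n.+1%:R - s by rewrite -natr1; lra.
apply: (@le_trans _ _ (((n.+1%:R - s) / n.+1%:R) ^+ 2)).
  by rewrite ler_pXn2r// nnegrE ?powR_ge0// divr_ge0// ltW.
have Nps : 0 < n.+1%:R + s by lra.
rewrite expr_div_n ler_pdivrMr ?exprn_gt0// mulrAC ler_pdivlMr//.
rewrite -subr_ge0 [leRHS](_ : _ = s ^+ 2 * (n.+1%:R - s)); last by ring.
by rewrite mulr_ge0 ?sqr_ge0.
Qed.

End ExpBounds.

(** * Comparison of the tails with theta and theta0 *)

Section TailBounds.
Context {R : realType}.
Implicit Types (s alpha : R) (n : nat).
Set Implicit Arguments.
Unset Strict Implicit.

Lemma ctail_powR_le alpha m n : 0 < alpha < 2 -> (0 < m <= n)%N ->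
  ctail alpha n * n%:R `^ alpha <= ctail alpha m * m%:R `^ alpha.
Proof.
move=> a02 /andP[m0]; have /andP[a0 a2] := a02.
elim: n => [|n ih]; first by rewrite leqn0 => /eqP->.
rewrite leq_eqVlt => /predU1P[<-//|]; rewrite ltnS => mn.
apply: le_trans (ih mn); rewrite ctailS// -mulrA.
have n0 : (0 < n)%N by exact: leq_trans mn.
have t0 : 0 < ctail alpha n by case: n n0 {ih mn} => // n _; exact: ctail_gt0.
rewrite ler_pM2l//.
have s01 : 0 <= alpha / 2 <= 1 by apply/andP; split; lra.
have := @powR_ratio_le R (alpha / 2) n s01 n0.
rewrite (_ : 2 * (alpha / 2) = alpha); last by field.
have p0 : 0 < n.+1%:R `^ alpha :> R by rewrite powR_gt0 ?ltr0n.
move=> h; apply: le_trans (_ : (n%:R / n.+1%:R) `^ alpha * n.+1%:R `^ alpha <= _).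
  by rewrite ler_pM2r.
by rewrite -powRM ?divr_ge0// divfK.
Qed.

Lemma ctail_powR_ge alpha m n : 0 < alpha < 2 -> (1 < m <= n)%N ->
  ctail alpha m * m.-1%:R `^ alpha <= ctail alpha n * n.-1%:R `^ alpha.
Proof.
move=> a02 /andP[m0]; have /andP[a0 a2] := a02.
elim: n => [|n ih]; first by rewrite leqn0 => /eqP->.
rewrite leq_eqVlt => /predU1P[<-//|]; rewrite ltnS => mn.
apply: le_trans (ih mn) _; rewrite ctailS// -mulrA.
case: n mn {ih} => [|n] mn; first by lia.
have n0 : (0 < n)%N by lia.
rewrite ler_pM2l ?ctail_gt0//.
have s01 : 0 <= alpha / 2 <= 1 by apply/andP; split; lra.
have := @powR_ratio_ge R (alpha / 2) n s01 n0.
rewrite (_ : 2 * (alpha / 2) = alpha); last by field.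
have p0 : 0 < n.+1%:R `^ alpha :> R by rewrite powR_gt0 ?ltr0n.
move=> h; apply: le_trans (_ : (n%:R / n.+1%:R) `^ alpha * n.+1%:R `^ alpha <= _).
  by rewrite -powRM ?divr_ge0// divfK.
by rewrite ler_pM2r.
Qed.

(* With [x = (1+2s)/(5+s)], the left-hand side is [((1-x) e^x)^(5+s)]. *)
Lemma theta_factor_le s : 1 / 2 <= s <= 1 ->
  (1 - (1 + 2 * s) / (5 + s)) `^ (5 + s) * expR (1 + 2 * s)
  <= (1 + (1 + 2 * s) ^+ 2 / (2 * (5 + s))
        + ((1 + 2 * s) ^+ 2 / (2 * (5 + s))) ^+ 2 / 2)^-1.
Proof.
move=> /andP[s0 s1]; set x := (1 + 2 * s) / (5 + s); set q := _ / (2 * (5 + s)).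
have s5 : 0 < 5 + s by lra.
have x0 : 0 <= x by rewrite divr_ge0; lra.
have x1 : x < 1 by rewrite /x ltr_pdivrMr//; lra.
have q0 : 0 <= q by rewrite divr_ge0 ?sqr_ge0; lra.
(* [onem_expR_le] bounds (1-x) e^x by e^(-x^2/2), and x^2 (5+s)/2 is exactly q. *)
apply: (@le_trans _ _ (expR (- q))).
  have -> : 1 + 2 * s = x * (5 + s) by rewrite /x divfK// gt_eqF.
  have x1' : 0 <= 1 - x by lra.
  rewrite expRM -powRM// ?expR_ge0//.
  have := @onem_expR_le R x; rewrite x0 x1 => /(_ isT) h.
  have -> : - q = - (x ^+ 2 / 2) * (5 + s).
    by rewrite /q /x; field; rewrite gt_eqF.
  rewrite [leRHS]expRM; apply: ge0_ler_powR => //; rewrite ?nnegrE ?expR_ge0//; first lra.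
  by rewrite mulr_ge0 ?expR_ge0; lra.
rewrite expRN lef_pV2 ?posrE ?expR_gt0//; first exact: expR_ge_quadratic.
by have := sqr_ge0 q; lra.
Qed.

(** Written as (3/2) (2/3)^(-(2s-1)), the power is at least (3/2) (1 + (2s-1)/3) = 1 + s, with
    equality at s = 1/2. *)
Lemma powR_94_ge s : 1 / 2 <= s <= 1 -> 1 + s <= (9 / 4) `^ s :> R.
Proof.
move=> /andP[s0 s1]; have -> : (9 / 4 : R) = (3 / 2) `^ 2%:R.
  by rewrite powR_mulrn//; field.
have -> : ((3 / 2) `^ 2%:R) `^ s = 3 / 2 * (2 / 3) `^ (- (2 * s - 1)) :> R.
  rewrite -powRrM -[in RHS](powRr1 (_ : 0 <= 3 / 2)); last by lra.
  rewrite -[2 / 3]invf_div -[(3 / 2)^-1]powR_inv1; last by lra.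
  rewrite -[in X in _ = _ * X]powRrM -powRD; last first.
    by apply/implyP => _; rewrite gt_eqF//; lra.
  by congr (_ `^ _); ring.
have := @powR_bernoulliN R (2 * s - 1) (2 / 3).
have -> : 0 <= 2 * s - 1 <= 1 by apply/andP; split; lra.
rewrite divr_gt0// => /(_ isT isT); lra.
Qed.

(* In [u = 2 s - 1] this is a polynomial inequality on [0, 1] that follows from
   bounding each [u ^+ k], [k >= 2], between [0] and [u]. *)
Lemma ctail4_ge_poly s : 1 / 2 <= s <= 1 ->
  4 / 3 <= (2 - s) * (3 - s) * (1 + s) ^+ 2 / ((2 + s) * (3 + s))
    * (1 + (1 + 2 * s) ^+ 2 / (2 * (5 + s))
        + ((1 + 2 * s) ^+ 2 / (2 * (5 + s))) ^+ 2 / 2).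
Proof.
move=> /andP[s0 s1].
set F := 5 + s; set N := (1 + 2 * s) ^+ 2; set A := (2 - s) * (3 - s) * _.
set B := (2 + s) * (3 + s).
have F0 : 0 < F by rewrite /F; lra.
have B0 : 0 < B by rewrite mulr_gt0; lra.
have -> : A / B * (1 + N / (2 * F) + (N / (2 * F)) ^+ 2 / 2) =
    A * (8 * F ^+ 2 + 4 * N * F + N ^+ 2) / (8 * B * F ^+ 2).
  by field; rewrite !gt_eqF.
have BF0 : 0 < 8 * B * F ^+ 2 by rewrite mulr_gt0 ?exprn_gt0// mulr_gt0.
rewrite ler_pdivlMr// -subr_ge0.
pose u := 2 * s - 1.
have u0 : 0 <= u by rewrite /u; lra.
have u1 : u <= 1 by rewrite /u; lra.
have su : s = (1 + u) / 2 by rewrite /u; field.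
rewrite [leRHS](_ : _ = 2305 / 24 + 2155 / 6 * u - 133 * u ^+ 2
    - 4237 / 24 * u ^+ 3 - 3113 / 48 * u ^+ 4 - 81 / 8 * u ^+ 5
    + 3 / 4 * u ^+ 6 + 1 / 2 * u ^+ 7 + 1 / 16 * u ^+ 8); last first.
  by rewrite /A /B /N /F su; field.
have ux k : 0 <= u ^+ k.+1 <= u.
  by rewrite exprn_ge0//= exprS ler_piMr// exprn_ile1.
move: (ux 1) (ux 2) (ux 3) (ux 4) (ux 5) (ux 6) (ux 7).
move: (u ^+ 2) (u ^+ 3) (u ^+ 4) (u ^+ 5) (u ^+ 6) (u ^+ 7) (u ^+ 8).
move=> u2 u3 u4 u5 u6 u7 u8.
move=> /andP[? ?] /andP[? ?] /andP[? ?] /andP[? ?] /andP[? ?] /andP[? ?] /andP[? ?]; lra.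
Qed.

Definition theta_of alpha : R :=
  (1 - (1 + alpha) / (5 + alpha / 2)) `^ (5 + alpha / 2) * expR (1 + alpha)
    * Gamma (alpha + 1) * sin (pi * alpha / 2) / (pi * alpha).

Definition theta0_of alpha : R :=
  Num.sqrt 2 * expR (13 / 12) * Gamma (1 + alpha) * sin (pi * alpha / 2)
    / (pi * alpha).

Lemma Gamma_pos (x : R) : 0 < x -> Gamma x = GammaPos x.
Proof. by rewrite /Gamma => ->. Qed.

Lemma ctail_first alpha n : 0 < alpha < 2 ->
  ctail alpha n.+1 = Gamma (alpha + 1) / GammaPos (1 + alpha / 2) ^+ 2 / 2 *
    \prod_(k < n) ((k.+1%:R - alpha / 2) / (k.+1%:R + alpha / 2)).
Proof.
move=> a02; have /andP[a0 a2] := a02.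
elim: n => [|n ih]; last by rewrite ctailS// ih big_ord_recr/= -[LHS]mulrA.
rewrite big_ord0 mulr1 ctail1// coef0E// [alpha / 2 + 1]addrC.
by rewrite (@Gamma_pos (1 + _))// addr_gt0// divr_gt0.
Qed.

(** After bounding the sine, the power-exponential factor and Gamma(1+s) separately, both sides
    share the factor Gamma(alpha+1) (1-s)/2, and what remains is [ctail4_ge_poly]. *)
Lemma theta_le alpha : 1 < alpha < 2 ->
  0 < theta_of alpha <= ctail alpha 4 * 3 `^ alpha.
Proof.
move=> /andP[a1 a2]; pose s := alpha / 2.
have aE : alpha = 2 * s by rewrite /s; field.
have s12 : 1 / 2 <= s <= 1 by apply/andP; split; rewrite /s; lra.
have s0 : 1 / 2 < s by rewrite /s; lra.
have s1 : s < 1 by rewrite /s; lra.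
have pi0 := pi_gt0 R; have pi3 := @pi_ge3 R.
have a02 : 0 < alpha < 2 by rewrite (lt_trans _ a1).
have G0 : 0 < Gamma (alpha + 1) by rewrite Gamma_pos ?GammaPos_gt0//; lra.
rewrite ctail_first// /theta_of -/s.
rewrite [pi * alpha / 2](_ : _ = pi * s); last by rewrite /s mulrA.
rewrite [in 1 + alpha]aE [in pi * alpha]aE.
set G := Gamma _ in G0 *; set K := (X in X * G * _).
have K0 : 0 < K.
  rewrite mulr_gt0 ?expR_gt0// powR_gt0// subr_gt0 ltr_pdivrMr; lra.
have sin0 : 0 < sin (pi * s).
  apply: sin_gt0_pi; apply/andP; split; first by rewrite mulr_gt0//; lra.
  by rewrite gtr_pMr.
apply/andP; split.
  apply: divr_gt0; first exact: mulr_gt0 (mulr_gt0 K0 G0) sin0.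
  by rewrite mulr_gt0//; lra.
have Kle := theta_factor_le s12; rewrite -/K in Kle.
have poly := ctail4_ge_poly s12.
set E := (X in X^-1) in Kle; rewrite -/E in poly.
have E0 : 0 < E.
  by rewrite -invr_gt0; exact: lt_le_trans Kle.
have h1 : K * (4 / 3) <= (2 - s) * (3 - s) * (1 + s) ^+ 2 / ((2 + s) * (3 + s)).
  apply: le_trans (ler_wpM2r _ Kle) _; first by rewrite divr_ge0.
  by rewrite mulrC ler_pdivrMr.
(* From sin(pi s) <= 4s(1-s) and pi >= 3; the factor 1-s is kept because the tail also vanishes at s
   = 1. *)
have h2 : sin (pi * s) / (pi * (2 * s)) <= 2 / 3 * (1 - s).
  have := @sin_pi_le R s s12 => h.
  rewrite ler_pdivrMr; last by rewrite !mulr_gt0//; lra.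
  apply: le_trans h _.
  rewrite -subr_ge0 [leRHS](_ : _ = (4 / 3 * (s * (1 - s))) * (pi - 3)); last by field.
  by rewrite !mulr_ge0//; lra.
have g0 : 0 < GammaPos (1 + s) by rewrite GammaPos_gt0//; lra.
have h3 : (1 + s) ^+ 2 / 4 `^ s <= (GammaPos (1 + s) ^+ 2)^-1.
  have s01 : 0 <= s <= 1 by apply/andP; split; lra.
  have := @GammaPos1D_le R s s01 => h.
  rewrite -[leLHS]invrK lef_pV2 ?posrE ?exprn_gt0 ?invr_gt0//; last first.
    by rewrite divr_gt0 ?powR_gt0 ?exprn_gt0//; lra.
  rewrite invf_div (_ : (4 : R) = 2 `^ 2%:R); last by rewrite powR_mulrn//; ring.
  rewrite powRAC powR_mulrn ?powR_ge0// -expr_div_n.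
  by rewrite ler_pXn2r// nnegrE ?(ltW g0)// divr_ge0 ?powR_ge0//; lra.
have h4 := powR_94_ge s12.
have p4 : 0 < 4 `^ s :> R by rewrite powR_gt0.
(* The factor 4^s cancels the one in [h3]; the factor (9/4)^s is estimated by [h4]. *)
have e3 : 3 `^ alpha = 4 `^ s * (9 / 4) `^ s :> R.
  rewrite -powRM ?divr_ge0//.
  rewrite (_ : 4 * (9 / 4) = 3 `^ 2%:R :> R); last by rewrite powR_mulrn//; field.
  by rewrite -powRrM aE.
rewrite !big_ord_recr big_ord0/= mul1r e3.
pose P : R := (1 - s) / (1 + s) * ((2 - s) / (2 + s)) * ((3 - s) / (3 + s)).
rewrite -/P; have P0 : 0 <= P by rewrite !mulr_ge0 ?invr_ge0//; lra.
apply: (@le_trans _ _ (K * G * (2 / 3 * (1 - s)))).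
  by rewrite -mulrA ler_wpM2l// ltW// mulr_gt0.
apply: (@le_trans _ _ (G * ((1 + s) ^+ 2 / 4 `^ s) / 2 * P *
    (4 `^ s * (1 + s)))); last first.
  apply: ler_pM => //.
  - by rewrite mulr_ge0// divr_ge0// mulr_ge0 ?(ltW G0)// divr_ge0 ?sqr_ge0 ?powR_ge0.
  - by rewrite mulr_ge0 ?powR_ge0//; lra.
  - by rewrite ler_wpM2r// ler_wpM2r ?invr_ge0// ler_wpM2l// ltW.
  - by rewrite ler_wpM2l ?powR_ge0.
have -> : G * ((1 + s) ^+ 2 / 4 `^ s) / 2 * P * (4 `^ s * (1 + s)) =
    G * ((1 - s) / 2) * ((2 - s) * (3 - s) * (1 + s) ^+ 2 / ((2 + s) * (3 + s))).
  by rewrite /P; field; rewrite !gt_eqF//; lra.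
have -> : K * G * (2 / 3 * (1 - s)) = G * ((1 - s) / 2) * (K * (4 / 3)) by field.
by rewrite ler_wpM2l// mulr_ge0 ?(ltW G0)//; lra.
Qed.

(** Squared, this is e^(13/6) >= 8. The quadratic bound gives e^(13/24) >= 27/16, and (27/16)^4 >
    8. *)
Lemma sqrt2_expR_ge4 : 4 <= Num.sqrt 2 * expR (13 / 12) :> R.
Proof.
rewrite -(@ler_pXn2r _ 2)// ?nnegrE ?mulr_ge0 ?sqrtr_ge0 ?expR_ge0//.
rewrite exprMn sqr_sqrtr// (_ : 13 / 12 = 2%:R * (13 / 24)); last by field.
rewrite expRM_natl -exprM.
have := @expR_ge_quadratic R (13 / 24) (divr_ge0 (ler0n _ _) (ler0n _ _)).
move=> h; have h27 : 27 / 16 <= expR (13 / 24) :> R by apply: le_trans h; lra.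
have : (27 / 16) ^+ 4 <= expR (13 / 24) ^+ 4 :> R.
  by rewrite ler_pXn2r// nnegrE ?expR_ge0//; lra.
rewrite (_ : (2 * 2 = 4)%N)//; lra.
Qed.

(** Uses Gamma(1+s) >= 2^(s-1), [sqrt2_expR_ge4] and sin(pi s) >= 2(1-s); after cancelling, pi s <=
    2(1+s) remains, which follows from pi < 4 and s <= 1. *)
Lemma theta0_ge alpha : 1 < alpha < 2 ->
  ctail alpha 2 * 2 `^ alpha <= theta0_of alpha.
Proof.
move=> /andP[a1 a2]; pose s := alpha / 2.
have aE : alpha = 2 * s by rewrite /s; field.
have s12 : 1 / 2 <= s <= 1 by apply/andP; split; rewrite /s; lra.
have s0 : 1 / 2 < s by rewrite /s; lra.
have s1 : s < 1 by rewrite /s; lra.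
have pi0 := pi_gt0 R; have pi2 := pihalf_lt2 R.
have a02 : 0 < alpha < 2 by rewrite (lt_trans _ a1).
have G0 : 0 < Gamma (alpha + 1) by rewrite Gamma_pos ?GammaPos_gt0//; lra.
rewrite ctail_first// /theta0_of -/s.
rewrite [pi * alpha / 2](_ : _ = pi * s); last by rewrite /s mulrA.
rewrite [1 + alpha]addrC [in pi * alpha]aE.
set G := Gamma _ in G0 *; set K := (X in X * G * _).
have K4 : 4 <= K by exact: sqrt2_expR_ge4.
have h2 := @sin_pi_ge R s s12.
rewrite big_ord_recr big_ord0/= mul1r.
have h3 : (GammaPos (1 + s) ^+ 2)^-1 <= 4 / 2 `^ alpha.
  have s01 : 0 <= s <= 1 by apply/andP; split; lra.
  have := @GammaPos1D_ge R s s01 => h.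
  rewrite -[leRHS]invrK invf_div.
  rewrite lef_pV2 ?posrE ?exprn_gt0 ?divr_gt0 ?powR_gt0//; last first.
    by apply: lt_le_trans h; rewrite powR_gt0.
  apply: (@le_trans _ _ ((2 `^ (s - 1)) ^+ 2)); last first.
    by rewrite ler_pXn2r// nnegrE ?powR_ge0// (le_trans _ h)// powR_ge0.
  rewrite -powR_mulrn ?powR_ge0// -powRrM.
  rewrite (_ : (s - 1) * 2%:R = alpha - 2%:R); last by rewrite aE; ring.
  rewrite powRB; last by apply/implyP => _; rewrite pnatr_eq0.
  by rewrite powR_mulrn// (_ : 2 ^+ 2 = 4 :> R)//; ring.
have p2 : 0 < 2 `^ alpha :> R by rewrite powR_gt0.
set Q := (1 - s) / (1 + s).
have Q0 : 0 <= Q by rewrite divr_ge0; lra.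
apply: (@le_trans _ _ (G * (4 / 2 `^ alpha) / 2 * Q * 2 `^ alpha)).
  by rewrite ler_wpM2r ?powR_ge0// ler_wpM2r// ler_wpM2r// ler_wpM2l// ltW.
rewrite ler_pdivlMr ?mulr_gt0//; [|lra..].
apply: (@le_trans _ _ (4 * G * (2 * (1 - s)))); last first.
  apply: ler_pM => //.
  - by rewrite mulr_ge0// ltW.
  - by lra.
  - by rewrite ler_wpM2r// ltW.
have -> : G * (4 / 2 `^ alpha) / 2 * Q * 2 `^ alpha * (pi * (2 * s)) =
   4 * G * (1 - s) * (pi * s / (1 + s)).
  by rewrite /Q; field; rewrite !gt_eqF//; lra.
rewrite [2 * _]mulrC [in leRHS]mulrA ler_wpM2l ?mulr_ge0 ?(ltW G0)//; first lra.
rewrite ler_pdivrMr; last lra.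
have : 0 <= (4 - pi) * s by rewrite mulr_ge0; lra.
lra.
Qed.

(** Comparison with index 4 gives the bound with n - 1. The weaker n + 1/2 is what is needed: at n =
    M/2 it equals (M+1)/2, the quantity that cancels against the mesh width. *)
Lemma ctail_ge_theta alpha n : 1 < alpha < 2 -> (4 <= n)%N ->
  theta_of alpha / (n%:R + 1 / 2) `^ alpha <= ctail alpha n.
Proof.
move=> a12 n4; have /andP[a1 a2] := a12.
have a02 : 0 < alpha < 2 by rewrite (lt_trans _ a1).
have /andP[th0 th] := theta_le a12.
have n0 := ler0n R n.
rewrite ler_pdivrMr; last by rewrite powR_gt0; lra.
apply: le_trans th _.
apply: le_trans (@ctail_powR_ge alpha 4 n a02 _) _; first by rewrite n4.
rewrite ler_wpM2l//.
  by case: n n4 {n0} => // n _; rewrite ltW// ctail_gt0.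
apply: ge0_ler_powR; rewrite ?nnegrE//; [lra..|].
case: n n4 n0 => // n _ _; rewrite -[n.+1%:R]natr1/=; lra.
Qed.

(** Comparison with index 2. In the application the ceiling is n + 1 and k0 is n + 2, so the tail
    beyond k0 starts at [n.+3]. *)
Lemma ctail_le_theta0 alpha n : 1 < alpha < 2 ->
  ctail alpha n.+3 <= theta0_of alpha / n.+1%:R `^ alpha.
Proof.
move=> a12; have /andP[a1 a2] := a12.
have a02 : 0 < alpha < 2 by rewrite (lt_trans _ a1).
rewrite ler_pdivlMr ?powR_gt0//.
apply: le_trans (theta0_ge a12).
apply: le_trans (@ctail_powR_le alpha 2 n.+3 a02 _) => //.
rewrite ler_wpM2l ?(ltW (ctail_gt0 _ a02))//.
apply: ge0_ler_powR; rewrite ?nnegrE//; first lra.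
by rewrite ler_nat; lia.
Qed.

End TailBounds.

(** * Norms and ranks of real matrices *)

Section MatrixNorms.
Context {R : realType}.
Set Implicit Arguments.
Unset Strict Implicit.

Definition sqnorm n (x : 'cV[R]_n) : R := \sum_(i < n) x i 0 ^+ 2.

Definition cdot n (x y : 'cV[R]_n) : R := \sum_(i < n) x i 0 * y i 0.

Lemma sqnorm_ge0 n (x : 'cV[R]_n) : 0 <= sqnorm x.
Proof. by apply: sumr_ge0 => i _; exact: sqr_ge0. Qed.

Lemma sqnorm_eq0 n (x : 'cV[R]_n) : sqnorm x = 0 -> x = 0.
Proof.
move/eqP; rewrite psumr_eq0 => [/allP h|i _]; last exact: sqr_ge0.
apply/colP => i; rewrite mxE.
by have := h i (mem_index_enum _); rewrite /= sqrf_eq0 => /eqP.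
Qed.

Lemma cdotE n (x y : 'cV[R]_n) : (x^T *m y) 0 0 = cdot x y.
Proof. by rewrite mxE; apply: eq_bigr => i _; rewrite mxE. Qed.

Lemma cdot_adj n (A : 'M[R]_n) (x y : 'cV[R]_n) :
  cdot (A *m x) y = cdot x (A^T *m y).
Proof. by rewrite -!cdotE trmx_mul mulmxA. Qed.

Lemma cdotC n (x y : 'cV[R]_n) : cdot x y = cdot y x.
Proof. by apply: eq_bigr => i _; rewrite mulrC. Qed.

Lemma sqnormB n (x y : 'cV[R]_n) : sqnorm (x - y) = sqnorm x - 2 * cdot x y + sqnorm y.
Proof.
rewrite /sqnorm /cdot mulr_sumr -sumrB -big_split/=.
by apply: eq_bigr => i _; rewrite !mxE; ring.
Qed.

Lemma sqnormD n (x y : 'cV[R]_n) : sqnorm (x + y) = sqnorm x + 2 * cdot x y + sqnorm y.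
Proof.
rewrite /sqnorm /cdot mulr_sumr -!big_split/=.
by apply: eq_bigr => i _; rewrite !mxE; ring.
Qed.

Lemma sqnormZ n (a : R) (x : 'cV[R]_n) : sqnorm (a *: x) = a ^+ 2 * sqnorm x.
Proof.
by rewrite /sqnorm mulr_sumr; apply: eq_bigr => i _; rewrite !mxE exprMn.
Qed.

Lemma cdotDr n (x y z : 'cV[R]_n) : cdot x (y + z) = cdot x y + cdot x z.
Proof. by rewrite /cdot -big_split; apply: eq_bigr => i _; rewrite mxE mulrDr. Qed.

Lemma cdotZr n (a : R) (x y : 'cV[R]_n) : cdot x (a *: y) = a * cdot x y.
Proof. by rewrite /cdot mulr_sumr; apply: eq_bigr => i _; rewrite mxE mulrCA. Qed.

Lemma cdotxx n (x : 'cV[R]_n) : cdot x x = sqnorm x.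
Proof. by []. Qed.

Lemma sqnorm_col_mx m n (u : 'cV[R]_m) (v : 'cV[R]_n) :
  sqnorm (col_mx u v) = sqnorm u + sqnorm v.
Proof.
rewrite /sqnorm big_split_ord/=; congr (_ + _); apply: eq_bigr => i _.
  by rewrite col_mxEu.
by rewrite col_mxEd.
Qed.

Lemma specnorm_le m n (A : 'M[R]_(m, n)) (c : R) : (0 < n)%N -> 0 <= c ->
  (forall x, sqnorm (A *m x) <= c ^+ 2 * sqnorm x) -> specnorm A <= c.
Proof.
case: n A => // n A _ c0 h; apply: ge_sup => [|_ [x /= x1 <-]].
  exists (vnorm2 (A *m delta_mx 0 0)); exists (delta_mx 0 0) => //=.
  rewrite /vnorm2 (bigD1 0)//= big1 => [|i /negPf i0].
    by rewrite !mxE !eqxx expr1n addr0 sqrtr1.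
  by rewrite mxE i0 expr0n.
rewrite -[leRHS](ger0_norm c0) -sqrtr_sqr ler_wsqrtr//.
have := h x; rewrite (_ : sqnorm x = 1) ?mulr1//.
move: x1; rewrite /vnorm2 -/(sqnorm x) => x1.
by rewrite -[LHS]sqr_sqrtr ?sqnorm_ge0// x1 expr1n.
Qed.

(** [kermx] describes the kernel acting on rows, hence the passage through transposes. *)
Lemma unitmx_inj n (A : 'M[R]_n) : (forall x : 'cV_n, A *m x = 0 -> x = 0) ->
  A \in unitmx.
Proof.
move=> h; rewrite -unitmx_tr -row_free_unit -kermx_eq0.
apply/eqP/row_matrixP => i; rewrite row0.
apply: trmx_inj; rewrite trmx0; apply: h.
apply: trmx_inj; rewrite trmx_mul trmxK trmx0 -row_mul mulmx_ker.
exact: row0.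
Qed.

(** * Lower bounds for a symmetric matrix with skew coupling *)

Section SkewBlock.
Variables (n : nat) (S : 'M[R]_n) (lam w : R).
Hypothesis symS : S^T = S.
Hypothesis lamS : forall x, lam * sqnorm x <= cdot x (S *m x).
Hypothesis lamw : 0 <= w + lam.

Let A : 'M[R]_n := w%:M + S.

Lemma sqnorm_shift x : (w + lam) ^+ 2 * sqnorm x <= sqnorm (A *m x).
Proof.
have hA : (w + lam) * sqnorm x <= cdot x (A *m x).
  rewrite /A mulmxDl mul_scalar_mx cdotDr cdotZr cdotxx mulrDl lerD2l.
  exact: lamS.
(* Expanding |A x - (w + lam) x|^2 >= 0 takes the place of the Cauchy-Schwarz inequality. *)
have := sqnorm_ge0 (A *m x - (w + lam) *: x).
rewrite sqnormB sqnormZ cdotZr [cdot (A *m x) _]cdotC.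
have := ler_wpM2l lamw hA; lra.
Qed.

(* For the skew coupling the cross terms [- 2 <A u, v> + 2 <u, A v>] cancel. *)
Lemma sqnorm_calH x : (1 + (w + lam) ^+ 2) * sqnorm x
  <= sqnorm ((w%:M + calH S) *m x).
Proof.
rewrite -(vsubmxK x); set u := usubmx x; set v := dsubmx x.
have -> : (w%:M + calH S) *m col_mx u v = col_mx (A *m u - v) (u + A *m v).
  rewrite /calH scalar_mx_block add_block_mx mul_block_col !add0r.
  by rewrite mulNmx !mul1mx.
rewrite !sqnorm_col_mx sqnormB sqnormD.
have -> : cdot (A *m u) v = cdot u (A *m v).
  by rewrite cdot_adj /A linearD/= tr_scalar_mx symS.
have := sqnorm_shift u; have := sqnorm_shift v; lra.
Qed.

Lemma unitmx_calH : w%:M + calH S \in unitmx.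
Proof.
apply: unitmx_inj => x hx; apply: sqnorm_eq0.
have := sqnorm_calH x; rewrite hx.
have -> : sqnorm (0 : 'cV[R]_(n + n)) = 0.
  by rewrite /sqnorm big1// => i _; rewrite mxE expr0n.
have s0 := sqr_ge0 (w + lam).
rewrite pmulr_rle0; last by lra.
by move=> h; apply/eqP; rewrite eq_le h sqnorm_ge0.
Qed.

Lemma sqnorm_invmx_calH y : sqnorm (invmx (w%:M + calH S) *m y)
  <= (1 + (w + lam) ^+ 2)^-1 * sqnorm y.
Proof.
rewrite mulrC ler_pdivlMr; last by have := sqr_ge0 (w + lam); lra.
rewrite mulrC; apply: le_trans (sqnorm_calH _) _.
by rewrite mulmxA mulmxV ?mul1mx// unitmx_calH.
Qed.

End SkewBlock.

(** Every entry of B x is at most r |x| in modulus; adding n squares produces the factor n, the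
    source of M^(1/2) in the final bounds. *)
Lemma sqnorm_rowsum n (B : 'M[R]_n) (r : R) (x : 'cV[R]_n) :
  (forall i, \sum_j `|B i j| <= r) -> sqnorm (B *m x) <= n%:R * r ^+ 2 * sqnorm x.
Proof.
move=> hr; have x0 := sqnorm_ge0 x.
have xle j : `|x j 0| <= Num.sqrt (sqnorm x).
  rewrite -sqrtr_sqr ler_wsqrtr// /sqnorm (bigD1 j)//= lerDl.
  by apply: sumr_ge0 => i _; exact: sqr_ge0.
have -> : n%:R * r ^+ 2 * sqnorm x = \sum_(i < n) (r * Num.sqrt (sqnorm x)) ^+ 2.
  by rewrite sumr_const card_ord exprMn sqr_sqrtr// -[LHS]mulrA mulr_natl.
apply: ler_sum => i _.
have r0 : 0 <= r := le_trans (sumr_ge0 _ (fun j _ => normr_ge0 _)) (hr i).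
rewrite -[leLHS]real_normK ?num_real//.
rewrite ler_pXn2r// ?nnegrE ?normr_ge0 ?mulr_ge0 ?sqrtr_ge0// mxE.
apply: le_trans (ler_norm_sum _ _ _) _.
apply: (@le_trans _ _ (\sum_j `|B i j| * Num.sqrt (sqnorm x))).
  by apply: ler_sum => j _; rewrite normrM ler_wpM2l.
by rewrite -mulr_suml ler_wpM2r ?sqrtr_ge0.
Qed.

Lemma sqnorm_diag_rowsum n (B : 'M[R]_n) (r : R) (x : 'cV[R]_(n + n)) :
  (forall i, \sum_j `|B i j| <= r) ->
  sqnorm (block_mx B 0 0 B *m x) <= n%:R * r ^+ 2 * sqnorm x.
Proof.
move=> hr; rewrite -(vsubmxK x) mul_block_col !mul0mx addr0 add0r.
by rewrite !sqnorm_col_mx mulrDr lerD// sqnorm_rowsum.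
Qed.

(** A Gershgorin bound: each cross term is at least -|S_ij| (x_i^2 + x_j^2)/2, and by symmetry
    column sums obey the same bound r as row sums. *)
Lemma cdot_diag_dominant n (S : 'M[R]_n) (c r : R) (x : 'cV[R]_n) :
    S^T = S -> (forall i, S i i = c) ->
    (forall i, \sum_(j | j != i) `|S i j| <= r) ->
  (c - r) * sqnorm x <= cdot x (S *m x).
Proof.
move=> symS dS hr.
have symSE i j : S i j = S j i by rewrite -{1}symS mxE.
have -> : cdot x (S *m x) = c * sqnorm x +
    \sum_i \sum_(j | j != i) x i 0 * (S i j * x j 0).
  rewrite /sqnorm mulr_sumr -big_split/=; apply: eq_bigr => i _.
  by rewrite mxE (bigD1 i)//= dS mulrDr mulr_sumr expr2 mulrCA mulrA.
rewrite mulrBl lerD2l lerNl.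
have e1 : \sum_i \sum_(j | j != i) `|S i j| * x i 0 ^+ 2 <= r * sqnorm x.
  rewrite /sqnorm mulr_sumr; apply: ler_sum => i _.
  by rewrite -mulr_suml ler_wpM2r ?sqr_ge0.
have e2 : \sum_i \sum_(j | j != i) `|S i j| * x j 0 ^+ 2 <= r * sqnorm x.
  rewrite (exchange_big_dep xpredT)//=; apply: le_trans e1.
  apply: ler_sum => i _; under eq_bigl do rewrite eq_sym.
  by rewrite le_eqVlt; apply/orP; left; apply/eqP; apply: eq_bigr => j _; rewrite symSE.
suff : - (\sum_i \sum_(j | j != i) x i 0 * (S i j * x j 0)) <=
    (\sum_i \sum_(j | j != i) `|S i j| * x i 0 ^+ 2 +
     \sum_i \sum_(j | j != i) `|S i j| * x j 0 ^+ 2) / 2 by lra.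
rewrite -big_split/= mulr_suml -sumrN; apply: ler_sum => i _.
rewrite -big_split/= mulr_suml -sumrN; apply: ler_sum => j _.
rewrite -mulrDr -mulrN.
have h : - (x i 0 * (S i j * x j 0)) <= `|S i j| * `|x i 0 * x j 0|.
  by rewrite -normrM mulrCA (le_trans (ler_norm _))// normrN.
rewrite mulrN; apply: le_trans h _; rewrite -mulrA ler_wpM2l// normrM.
rewrite -[x i 0 ^+ 2]real_normK ?num_real// -[x j 0 ^+ 2]real_normK ?num_real//.
have := sqr_ge0 (`|x i 0| - `|x j 0|); lra.
Qed.

(** Reindexing along an injection into an interval; the values that are missed only add nonnegative
    terms. *)
Lemma sum_inj_le (I : finType) (A : {pred I}) (p : I -> nat) (g : nat -> R) m n :
    {in A &, injective p} -> (forall i, i \in A -> (m <= p i < n)%N) ->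
    (forall q, (m <= q < n)%N -> 0 <= g q) ->
  \sum_(i in A) g (p i) <= \sum_(m <= q < n) g q.
Proof.
move=> pinj pA g0.
have -> : \sum_(i in A) g (p i) = \sum_(q <- [seq p i | i <- enum A]) g q.
  by rewrite big_map big_enum.
set s := map _ _.
have us : uniq s.
  by rewrite map_inj_in_uniq ?enum_uniq// => i j; rewrite !mem_enum; exact: pinj.
have -> : \sum_(q <- s) g q = \sum_(m <= q < n | q \in s) g q.
  rewrite -[RHS]big_filter; apply: perm_big; apply: uniq_perm => //.
    by rewrite filter_uniq ?iota_uniq.
  move=> q; rewrite mem_filter mem_index_iota; case qs: (q \in s) => //=.
  by move/mapP: qs => [i]; rewrite mem_enum => /pA h ->.
rewrite [leRHS](bigID (fun q => q \in s))/= lerDl big_nat_cond sumr_ge0// => q.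
by case/andP => /g0.
Qed.

(** The hypotheses place the support in an upper right and a lower left triangle of side k, both
    with nonzero longest diagonals. All other rows vanish, and k + k <= n keeps the two groups of
    rows disjoint. *)
Lemma mxrank_corners n k (B : 'M[R]_n) : (k + k <= n)%N ->
    (forall i j : 'I_n, (i < n - k)%N -> (k <= i)%N -> B i j = 0) ->
    (forall i j : 'I_n, (i < k)%N -> (i + (n - k) <= j)%N = false -> B i j = 0) ->
    (forall i j : 'I_n, (n - k <= i)%N -> (j + (n - k) <= i)%N = false -> B i j = 0) ->
    (forall i j : 'I_n, (i < k)%N -> j = (i + (n - k))%N :> nat -> B i j != 0) ->
    (forall i j : 'I_n, (j < k)%N -> i = (j + (n - k))%N :> nat -> B i j != 0) ->
  \rank B = (k + k)%N.
Proof.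
move=> kn h0 hu hl hud hld.
have lt1 (i : 'I_k) : (i < n)%N by have := ltn_ord i; lia.
have lt2 (i : 'I_k) : (i + (n - k) < n)%N by have := ltn_ord i; lia.
pose f1 i := Ordinal (lt1 i); pose f2 i := Ordinal (lt2 i).
(* [f] lists the first k indices and then the last k; [g] exchanges the two halves, so that rows [f]
   and columns [g] put the two triangles on the block diagonal. *)
pose f (i : 'I_(k + k)) : 'I_n :=
  match fintype.split i with inl a => f1 a | inr a => f2 a end.
pose g (i : 'I_(k + k)) : 'I_n :=
  match fintype.split i with inl a => f2 a | inr a => f1 a end.
have fl a : f (lshift k a) = f1 a by rewrite /f (unsplitK (inl a)).
have fr a : f (rshift k a) = f2 a by rewrite /f (unsplitK (inr a)).
have gl a : g (lshift k a) = f2 a by rewrite /g (unsplitK (inl a)).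
have gr a : g (rshift k a) = f1 a by rewrite /g (unsplitK (inr a)).
have finj : injective f.
  move=> i j; case: (split_ordP i) => a ->; case: (split_ordP j) => b ->;
    rewrite ?fl ?fr => /(congr1 val)/= e.
  - by congr lshift; exact: val_inj.
  - by have := ltn_ord a; have := ltn_ord b; lia.
  - by have := ltn_ord a; have := ltn_ord b; lia.
  - by congr rshift; apply: val_inj; apply/eqP; rewrite -(eqn_add2r (n - k)) e.
have fsurj (i : 'I_n) : (i < k)%N || (n - k <= i)%N -> exists l, i = f l.
  case/orP => hi; first by exists (lshift k (Ordinal hi)); rewrite fl; exact: val_inj.
  have ik : (i - (n - k) < k)%N by have := ltn_ord i; lia.
  by exists (rshift k (Ordinal ik)); rewrite fr; apply: val_inj => /=; rewrite subnK.
apply/eqP; rewrite eqn_leq; apply/andP; split.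
  (* Upper bound: B factors through its 2k possibly nonzero rows. *)
  have -> : B = (\matrix_(i, l) (i == f l)%:R) *m rowsub f B.
    apply/matrixP => i j; rewrite mxE.
    case hi: ((i < k)%N || (n - k <= i)%N).
      have [l ->] := fsurj i hi.
      rewrite (bigD1 l)//= !mxE eqxx mul1r big1 ?addr0// => l' l'l.
      by rewrite !mxE (inj_eq finj) eq_sym (negPf l'l) mul0r.
    rewrite h0; [|by lia..].
    rewrite big1// => l _; rewrite !mxE.
    case: eqP => [il|_]; last by rewrite mul0r.
    have := hi; rewrite il; case: (split_ordP l) => a ->; rewrite ?fl ?fr/=.
      by rewrite ltn_ord.
    by rewrite leq_addl orbT.
  by rewrite (leq_trans (mxrankM_maxl _ _))// rank_leq_col.
(* Lower bound: a block diagonal submatrix with invertible triangular blocks. *)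
apply: (@leq_trans (\rank (mxsub f g B))); last first.
  have -> : mxsub f g B = (rowsub g (rowsub f B)^T)^T.
    by apply/matrixP => i j; rewrite !mxE.
  rewrite mxrank_tr rowsubE; apply: leq_trans (mxrankM_maxr _ _) _.
  by rewrite mxrank_tr rowsubE; exact: mxrankM_maxr.
rewrite mxrank_unit//.
have -> : mxsub f g B = block_mx (\matrix_(i, j) B (f1 i) (f2 j)) 0 0
                                 (\matrix_(i, j) B (f2 i) (f1 j)).
  apply/matrixP => i j; rewrite mxE.
  case: (split_ordP i) => a ->; case: (split_ordP j) => b ->.
  - by rewrite fl gl block_mxEul mxE.
  - rewrite fl gr block_mxEur mxE hu//=.
    by apply/negbTE; have := ltn_ord b; lia.
  - rewrite fr gl block_mxEdl mxE hl//=; first by lia.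
    by apply/negbTE; have := ltn_ord a; have := ltn_ord b; lia.
  - by rewrite fr gr block_mxEdr mxE.
rewrite unitmxE det_ublock unitrM; apply/andP; split.
  rewrite -det_tr det_trig.
    rewrite unitfE; apply/prodf_neq0 => i _; by rewrite !mxE; apply: hud => //=.
  apply/is_trig_mxP => i j ij; rewrite !mxE hu//=.
  by apply/negbTE; rewrite leq_add2r -ltnNge.
rewrite det_trig.
  rewrite unitfE; apply/prodf_neq0 => i _; by rewrite !mxE; apply: hld => //=.
apply/is_trig_mxP => i j ij; rewrite !mxE hl//=.
  exact: leq_addl.
by apply/negbTE; rewrite leq_add2r -ltnNge.
Qed.

End MatrixNorms.

(** * The difference of the Toeplitz and circulant matrices *)

Section ToeplitzMinusStrang.
Context {R : realType}.
Implicit Types (alpha mu : R) (M k : nat).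
Set Implicit Arguments.
Unset Strict Implicit.

(** The distance |i - j|: subtraction is truncated, so at least one summand is 0. *)
Definition absdiff (i j : nat) : nat := (i - j + (j - i))%N.

Lemma coef_absdiff alpha (i j : nat) :
  coef alpha (i%:Z - j%:Z) = coef alpha (absdiff i j).
Proof.
rewrite /absdiff; have [ij|/ltnW ij] := leqP i j.
  by rewrite -coef_opp opprB subzn// (eqP ij).
by rewrite subzn// (eqP ij) addn0.
Qed.

Lemma strang_firstB alpha M (m : nat) : ~~ odd M -> (0 < m < M)%N ->
  strang_first alpha M (M - m) = strang_first alpha M m.
Proof.
move=> Meven mM; rewrite /strang_first.
have M2 : (M = (M %/ 2) + (M %/ 2))%N by lia.
have [h|h|h] := ltngtP m (M %/ 2).
- rewrite ltnNge (_ : (M %/ 2 <= M - m)%N)/=; last by lia.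
  by rewrite (_ : (_ == _) = false) ?subKn//; [lia|apply/negbTE; lia].
- by rewrite (_ : (M - m < M %/ 2)%N); last by lia.
- by rewrite (_ : (M - m)%N = (M %/ 2)%N) ?ltnn ?eqxx//; lia.
Qed.

Lemma modn_shiftE (M i j : nat) : (i < M)%N -> (j < M)%N ->
  ((j + M - i) %% M = if i <= j then j - i else j + M - i)%N.
Proof.
move=> iM jM; case: leqP => ij; last by rewrite modn_small; lia.
by rewrite -addnBAC// modnDr modn_small; lia.
Qed.

(** The first row is symmetric under m -> M - m, which turns the cyclic index into |i - j| and
    allows an entrywise comparison with the Toeplitz matrix. *)
Lemma strang_first_mod alpha M (i j : nat) : ~~ odd M -> (i < M)%N -> (j < M)%N ->
  strang_first alpha M ((j + M - i) %% M) = strang_first alpha M (absdiff i j).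
Proof.
move=> Meven iM jM; rewrite modn_shiftE// /absdiff; case: leqP => ij.
  by rewrite (eqP ij).
rewrite (eqP (ltnW ij)) addn0.
by rewrite -(strang_firstB alpha Meven (m := (i - j)%N)); [congr strang_first|]; lia.
Qed.

Definition strang_defect alpha M (m : nat) : R := coef alpha m - strang_first alpha M m.

Lemma toepT_strangC alpha mu M (i j : 'I_M) : ~~ odd M ->
  (toepT alpha mu M - strangC alpha mu M) i j
    = mu * strang_defect alpha M (absdiff i j).
Proof.
move=> Meven; rewrite !mxE coef_absdiff strang_first_mod//.
by rewrite /strang_defect mulrBr.
Qed.

Lemma strang_defect_eq0 alpha M m : (m < M %/ 2)%N -> strang_defect alpha M m = 0.
Proof. by move=> mM; rewrite /strang_defect /strang_first mM subrr. Qed.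

(** The defect is c_(M/2) < 0 in the middle and c_m - c_(M-m) > 0 beyond, by strict monotonicity.
    This makes the rank of the corners exact. *)
Lemma strang_defect_neq0 alpha M m : 0 < alpha < 2 -> ~~ odd M -> (0 < M)%N ->
  (M %/ 2 <= m < M)%N -> strang_defect alpha M m != 0.
Proof.
move=> a02 Meven M0 /andP[Mm mM]; rewrite /strang_defect /strang_first ltnNge Mm/=.
case: (m =P (M %/ 2)%N) => [->|hm].
  have : (0 < M %/ 2)%N by lia.
  by case: (M %/ 2)%N => // q _; rewrite subr0 lt_eqF// coef_lt0.
by rewrite subr_eq0 gt_eqF// coef_increasing//; lia.
Qed.

Lemma strang_defect_le alpha M m : 0 < alpha < 2 -> ~~ odd M -> (0 < M)%N ->
  (M %/ 2 <= m < M)%N -> `|strang_defect alpha M m| <= - coef alpha (M - m)%N.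
Proof.
move=> a02 Meven M0 /andP[Mm mM]; rewrite /strang_defect /strang_first ltnNge Mm/=.
have hm : coef alpha m <= 0.
  by case: m Mm mM => [|m _ _]; [lia|rewrite ltW// coef_lt0].
case: (m =P (M %/ 2)%N) => [e|hM].
  by rewrite subr0 ler0_norm// e (_ : M - M %/ 2 = M %/ 2)%N//; lia.
have h : coef alpha (M - m)%N < coef alpha m by apply: coef_increasing => //; lia.
rewrite ger0_norm; last by rewrite subr_ge0 ltW.
lra.
Qed.

Lemma absdiffC i j : absdiff i j = absdiff j i.
Proof. by rewrite /absdiff addnC. Qed.

Lemma strangC_tr alpha mu M : ~~ odd M ->
  (strangC alpha mu M)^T = strangC alpha mu M.
Proof.
by move=> Meven; apply/matrixP => i j; rewrite !mxE !strang_first_mod// absdiffC.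
Qed.

(** The entry at M/2 is 0 and the two halves mirror each other; each telescopes to c_0/2 minus the
    tail at M/2. *)
Lemma sum_strang_first alpha M : 0 < alpha < 2 -> ~~ odd M -> (2 <= M)%N ->
  \sum_(1 <= r < M) `|strang_first alpha M r|
    = coef alpha 0 - 2 * ctail alpha (M %/ 2).
Proof.
move=> a02 Meven M2; set q := (M %/ 2)%N.
have q0 : (0 < q)%N by rewrite /q; lia.
have Mq : M = (q + q)%N by rewrite /q; lia.
have half : \sum_(1 <= r < q) `|strang_first alpha M r| = coef alpha 0 / 2 - ctail alpha q.
  rewrite -ctail1// -sum_coef//; apply: eq_big_nat => r /andP[r1 rq].
  rewrite /strang_first rq ltr0_norm//.
  by case: r r1 rq => // r _ _; exact: coef_lt0.
rewrite (big_cat_nat (n := q))//=; last by lia.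
rewrite [X in _ + X]big_ltn; last by lia.
rewrite [X in _ + (X + _)](_ : _ = 0); last first.
  by rewrite /strang_first ltnn eqxx normr0.
rewrite add0r [X in _ + X](_ : _ = \sum_(1 <= r < q) `|strang_first alpha M r|).
  by rewrite half; field.
rewrite [RHS]big_nat_rev/= (_ : \sum_(q.+1 <= i < M) _ =
   \sum_(1 + q <= i < q + q) `|strang_first alpha M i|); last by rewrite Mq.
rewrite big_addn addnK; apply: eq_big_nat => r /andP[r1 rq].
by rewrite -strang_firstB//; [congr `|strang_first _ _ _|; lia|lia].
Qed.

Lemma modn_shift_inj (M i j j' : nat) : (i < M)%N -> (j < M)%N -> (j' < M)%N ->
  (j + M - i = j' + M - i %[mod M])%N -> j = j'.
Proof.
move=> iM jM jM'; rewrite !modn_shiftE//.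
by have [h|h] := leqP i j; have [h'|h'] := leqP i j'; lia.
Qed.

Lemma modn_shift_gt0 (M i j : nat) : (i < M)%N -> (j < M)%N -> j != i ->
  (0 < (j + M - i) %% M)%N.
Proof. by move=> iM jM ji; rewrite modn_shiftE//; have [h|h] := leqP i j; lia. Qed.

Lemma strangC_coercive alpha mu M (x : 'cV[R]_M) : 0 < alpha < 2 -> 0 <= mu ->
  ~~ odd M -> (2 <= M)%N ->
  2 * mu * ctail alpha (M %/ 2) * sqnorm x <= cdot x (strangC alpha mu M *m x).
Proof.
move=> a02 mu0 Meven M2; set t := ctail _ _.
have -> : 2 * mu * t = mu * coef alpha 0 - mu * (coef alpha 0 - 2 * t) by ring.
apply: cdot_diag_dominant.
- exact: strangC_tr.
- by move=> i; rewrite mxE strang_first_mod// /absdiff subnn /strang_first divn_gt0// M2.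
move=> i; under eq_bigr do rewrite mxE normrM (ger0_norm mu0).
rewrite -mulr_sumr ler_wpM2l// -sum_strang_first//.
(* Each row is a cyclic permutation of the first, and index 0 is left to the diagonal. *)
apply: (@sum_inj_le R 'I_M [pred j | j != i] (fun j : 'I_M => (j + M - i) %% M)%N
  (fun r => `|strang_first alpha M r|)).
- move=> j1 j2 _ _ /= e; apply: val_inj.
  exact: modn_shift_inj (ltn_ord i) (ltn_ord j1) (ltn_ord j2) e.
- move=> j; rewrite inE => ji.
  by rewrite modn_shift_gt0 ?ltn_ord//= ltn_mod; lia.
- by move=> q _; exact: normr_ge0.
Qed.

Definition corner alpha mu M k : 'M[R]_M :=
  \matrix_(i, j) if (M - k <= absdiff i j)%N
                 then mu * strang_defect alpha M (absdiff i j) else 0.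

(** At a distance d >= M/2, the positions i - d and i + d cannot both lie in [0, M). *)
Lemma absdiff_inj M (i j j' : nat) : ~~ odd M -> (i < M)%N -> (j < M)%N -> (j' < M)%N ->
  (M %/ 2 <= absdiff i j)%N -> (M %/ 2 <= absdiff i j')%N ->
  (M - absdiff i j = M - absdiff i j')%N -> j = j'.
Proof. by rewrite /absdiff; lia. Qed.

(** The range says k < p <= l for p = M - |i - j|. Each p occurs at most once in a row, so the
    bounds -c_p telescope. *)
Lemma sum_strang_defect alpha mu M k l (i : 'I_M) : 0 < alpha < 2 -> 0 <= mu ->
  ~~ odd M -> (k <= l <= M %/ 2)%N ->
  \sum_(j : 'I_M | (M - l <= absdiff i j < M - k)%N)
     `|mu * strang_defect alpha M (absdiff i j)|
    <= mu * (ctail alpha k.+1 - ctail alpha l.+1).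
Proof.
move=> a02 mu0 Meven /andP[kl lM]; have iM := ltn_ord i.
under eq_bigr do rewrite normrM (ger0_norm mu0).
rewrite -mulr_sumr ler_wpM2l// -sum_coef//.
pose A := [pred j : 'I_M | M - l <= absdiff i j < M - k]%N.
apply: (@le_trans _ _ (\sum_(j in A) - coef alpha (M - absdiff i j)%N)).
  apply: ler_sum => j jA; apply: strang_defect_le => //; first by lia.
  by have := ltn_ord j; move: jA; rewrite /absdiff; lia.
apply: (@sum_inj_le R 'I_M A (fun j : 'I_M => M - absdiff i j)%N
  (fun r => - coef alpha r)).
- move=> j j'; rewrite !inE => jA jA' e; apply: val_inj.
  by apply: (@absdiff_inj M i j j') => //; lia.
- by move=> j; rewrite inE; have := ltn_ord j; rewrite /absdiff; lia.
- by move=> [|q] hq; [lia|rewrite oppr_ge0 ltW// coef_lt0].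
Qed.

Lemma corner_rowsum alpha mu M k (i : 'I_M) : 0 < alpha < 2 -> 0 <= mu ->
  ~~ odd M -> (k <= M %/ 2)%N ->
  \sum_j `|corner alpha mu M k i j| <= mu * (coef alpha 0 / 2 - ctail alpha k.+1).
Proof.
move=> a02 mu0 Meven kM; rewrite -ctail1//.
apply: le_trans (@sum_strang_defect alpha mu M 0 k i a02 mu0 Meven _); last by [].
rewrite [leRHS]big_mkcond/=; apply: ler_sum => j _; rewrite mxE.
have -> : (absdiff i j < M - 0)%N.
  by have := ltn_ord i; have := ltn_ord j; rewrite /absdiff; lia.
by rewrite andbT; case: ifP; rewrite ?normr0.
Qed.

Lemma corner_compl_rowsum alpha mu M k (i : 'I_M) : 0 < alpha < 2 -> 0 <= mu ->
  ~~ odd M -> (k <= M %/ 2)%N ->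
  \sum_j `|(toepT alpha mu M - strangC alpha mu M - corner alpha mu M k) i j|
    <= mu * ctail alpha k.+1.
Proof.
move=> a02 mu0 Meven kM.
apply: (@le_trans _ _ (mu * (ctail alpha k.+1 - ctail alpha (M %/ 2).+1))); last first.
  by rewrite ler_wpM2l// gerBl ltW// ctail_gt0.
(* Only distances from M/2 on contribute: the defect vanishes below. *)
apply: le_trans (@sum_strang_defect alpha mu M k (M %/ 2) i a02 mu0 Meven _); last by lia.
rewrite [leRHS]big_mkcond/=; apply: ler_sum => j _.
rewrite mxE toepT_strangC// !mxE.
have [h|h] := leqP (M - k) (absdiff i j).
  by rewrite subrr normr0; case: ifP.
rewrite subr0; case: ifP => // /negbT; rewrite andbT -ltnNge => h'.
by rewrite strang_defect_eq0 ?mulr0 ?normr0//; lia.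
Qed.

Lemma mxrank_corner alpha mu M k : 0 < alpha < 2 -> 0 < mu -> ~~ odd M ->
  (0 < k <= M %/ 2)%N -> \rank (corner alpha mu M k) = (k + k)%N.
Proof.
move=> a02 mu0 Meven /andP[k0 kM].
apply: mxrank_corners; first by lia.
- move=> i j h1 h2; rewrite mxE ifF//; apply/negbTE.
  by have := ltn_ord j; rewrite /absdiff; lia.
- move=> i j h1 h2; rewrite mxE ifF//; apply/negbTE.
  by have := ltn_ord j; move: h2; rewrite /absdiff; lia.
- move=> i j h1 h2; rewrite mxE ifF//; apply/negbTE.
  by have := ltn_ord i; have := ltn_ord j; move: h2; rewrite /absdiff; lia.
- move=> i j h1 h2; rewrite mxE ifT; last by rewrite /absdiff; lia.
  rewrite mulf_neq0 ?(gt_eqF mu0)// strang_defect_neq0//; first by lia.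
  by have := ltn_ord j; rewrite /absdiff; lia.
- move=> i j h1 h2; rewrite mxE ifT; last by rewrite /absdiff; lia.
  rewrite mulf_neq0 ?(gt_eqF mu0)// strang_defect_neq0//; first by lia.
  by have := ltn_ord i; rewrite /absdiff; lia.
Qed.

End ToeplitzMinusStrang.

(** * The preconditioned matrix *)

Section Preconditioner.
Context {R : realType}.
Set Implicit Arguments.
Unset Strict Implicit.

Lemma specnorm_invmx_calH n (S B : 'M[R]_n) (w L r : R) : (0 < n)%N ->
    S^T = S -> (forall x, L * sqnorm x <= cdot x (S *m x)) -> 0 <= w + L ->
    0 <= r -> (forall i, \sum_j `|B i j| <= r) ->
  specnorm (invmx (w%:M + calH S) *m block_mx B 0 0 B)
    <= Num.sqrt n%:R * r / Num.sqrt (1 + (w + L) ^+ 2).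
Proof.
move=> n0 symS LS wL r0 Br.
have d0 : 0 < 1 + (w + L) ^+ 2 by have := sqr_ge0 (w + L); lra.
apply: specnorm_le; first by rewrite addn_gt0 n0.
  by rewrite divr_ge0 ?mulr_ge0 ?sqrtr_ge0.
move=> x; rewrite -mulmxA.
apply: le_trans (sqnorm_invmx_calH symS LS wL _) _.
rewrite expr_div_n exprMn !sqr_sqrtr ?ler0n ?(ltW d0)// mulrC -!mulrA.
rewrite [_^-1 * _]mulrC !mulrA ler_wpM2r ?invr_ge0 ?(ltW d0)//.
rewrite -[n%:R * r * r]mulrA -expr2; exact: sqnorm_diag_rowsum.
Qed.

Lemma calB_unitmx n (D : 'M[R]_n) (w : R) : is_diag_mx D ->
  (forall i, D i i <= 0) -> 0 < w -> w%:M + calB D \in unitmx.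
Proof.
move=> dD D0 w0.
have u : w%:M - D \in unitmx.
  rewrite unitmxE det_trig.
    rewrite unitfE; apply/prodf_neq0 => i _; rewrite !mxE eqxx mulr1n gt_eqF//.
    by have := D0 i; lra.
  apply/is_trig_mxP => i j ij; rewrite !mxE (is_diag_mxP dD) ?subr0.
    by rewrite -val_eqE/= ltn_eqF.
  by rewrite neq_ltn ij.
rewrite /calB scalar_mx_block add_block_mx !addr0 unitmxE det_ublock unitrM.
by rewrite -!unitmxE u.
Qed.

Lemma calF_unitmx n (w : R) (B H : 'M[R]_(n + n)) : w != 0 ->
  w%:M + B \in unitmx -> w%:M + H \in unitmx -> calF w B H \in unitmx.
Proof.
move=> w0 uB uH; rewrite /calF unitmxZ ?unitmx_mul ?uB//.
by rewrite unitfE invr_eq0 mulf_neq0// pnatr_eq0.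
Qed.

(** The scalar and the factor w I + B are common and cancel; then w I + H = (w I + H') + (H -
    H'). *)
Lemma invmx_calF n (w : R) (B H H' : 'M[R]_(n + n)) : w != 0 ->
    w%:M + B \in unitmx -> w%:M + H' \in unitmx ->
  invmx (calF w B H') *m calF w B H = 1%:M + invmx (w%:M + H') *m (H - H').
Proof.
move=> w0 uB uH; have uF := calF_unitmx w0 uB uH.
rewrite -[RHS](mulKmx uF); congr (_ *m _).
rewrite /calF -scalemxAl; congr (_ *: _); rewrite -mulmxA; congr (_ *m _).
by rewrite mulmxDr mulmx1 mulKVmx// addrACA subrr addr0.
Qed.

Lemma calHB n (S T : 'M[R]_n) : calH S - calH T = block_mx (S - T) 0 0 (S - T).
Proof. by rewrite /calH opp_block_mx add_block_mx !subrr. Qed.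

Lemma ceilD1_nat (x : R) (m : nat) : 1 <= x -> x < m%:R ->
  exists n : nat, [/\ Num.ceil x + 1 = n.+2%:Z, x <= n.+1%:R & (n.+1 <= m)%N].
Proof.
move=> x1 xm; have : 0 < Num.ceil x by rewrite ceil_gt0; lra.
have : Num.ceil x <= m%:Z by rewrite ceil_le_int ltW.
have := ceil_ge x; case: (Num.ceil x) => // -[|n] // xn nm _.
by exists n; split => //; lia.
Qed.

End Preconditioner.

Theorem theorem4 (R : realType) (alpha gamma tau a b : R) (M : nat)
  (D : 'M[R]_M) (omega eps : R) :
  1 < alpha -> alpha < 2 -> 0 < gamma -> 0 < tau -> a < b ->
  (8 <= M)%N -> ~~ odd M ->
  is_diag_mx D -> (forall i, D i i <= 0) ->
  0 < omega ->
  let h := (b - a) / (M.+1)%:R in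
  let mu := gamma * tau / h `^ alpha in
  let theta :=
    (1 - (1 + alpha) / (5 + alpha / 2)) `^ (5 + alpha / 2) * expR (1 + alpha)
    * Gamma (alpha + 1) * sin (pi * alpha / 2) / (pi * alpha) in
  let theta0 :=
    Num.sqrt 2 * expR (13 / 12) * Gamma (1 + alpha) * sin (pi * alpha / 2)
    / (pi * alpha) in
  2 `^ alpha * mu * theta0 / (M%:R - 2) `^ alpha < eps ->
  eps <= mu * theta0 ->
  let k0 : int := Num.ceil ((mu * theta0 / eps) `^ alpha^-1) + 1 in
  let F := calF omega (calB D) (calH (toepT alpha mu M)) in
  let Ft := calF omega (calB D) (calH (strangC alpha mu M)) in
  let den := Num.sqrt (1 + (omega + 2 `^ (alpha + 1) * gamma * tau * theta
                                     / (b - a) `^ alpha) ^+ 2) in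
  exists E Fc : 'M[R]_(M + M),
    [/\ (\rank E)%:Z = 4 * k0,
        specnorm E <= Num.sqrt M%:R * mu / den
                      * (coef alpha 0 / 2 - theta / (M%:R - 1 / 2) `^ alpha),
        specnorm Fc <= Num.sqrt M%:R * eps / den,
        Ft \in unitmx
      & invmx Ft *m F = 1%:M + E + Fc].
Proof.
move=> a1 a2 g0 tau0 ab M8 Meven dD D0 w0.
have M0 : (0 < M)%N by lia.
have M_ge2 : (2 <= M)%N by lia.
have M_ge4 : (4 <= M %/ 2)%N by lia.
have Mhalf_gt0 : (1 <= M %/ 2)%N by lia.
have Mhalf : (2 * (M %/ 2) = M)%N by lia.
have le_half n : (n.+1 <= (M %/ 2).-1)%N -> (n.+2 <= M %/ 2)%N by lia.
have four k : (k + k + (k + k))%N%:Z = 4 * k%:Z by lia.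
move=> h mu theta theta0 eps_gt eps_le k0 F Ft den.
have a12 : 1 < alpha < 2 by rewrite a1.
have a02 : 0 < alpha < 2 by rewrite (lt_trans _ a1).
have /andP[alpha0 _] := a02.
have hE : h = (b - a) / M.+1%:R by [].
have muE : mu = gamma * tau / h `^ alpha by [].
have thE : theta = theta_of alpha by [].
have th0E : theta0 = theta0_of alpha by [].
clearbody h mu theta theta0.
have ba0 : 0 < b - a by rewrite subr_gt0.
have h0 : 0 < h by rewrite hE divr_gt0.
have mu0 : 0 < mu by rewrite muE divr_gt0 ?mulr_gt0 ?powR_gt0.
have /andP[th_gt0 _] := theta_le a12; rewrite -thE in th_gt0.
have th0_gt0 : 0 < theta0.
  rewrite th0E; apply: lt_le_trans (theta0_ge a12).
  by rewrite mulr_gt0 ?powR_gt0// ctail_gt0.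
have M8R : 8 <= M%:R :> R by rewrite ler_nat.
have M2p : 0 < (M%:R - 2) `^ alpha by rewrite powR_gt0; lra.
have eps0 : 0 < eps.
  apply: lt_trans eps_gt; apply: divr_gt0 => //.
  by apply: mulr_gt0 => //; apply: mulr_gt0 => //; rewrite powR_gt0.
have M2 : M%:R = 2 * (M %/ 2)%N%:R :> R.
  by rewrite -natrM Mhalf.
(* The argument of the ceiling. The upper bound on [eps] yields x >= 1, and the lower bound yields x
   < M/2 - 1. *)
pose x := (mu * theta0 / eps) `^ alpha^-1.
have xa : x `^ alpha = mu * theta0 / eps.
  rewrite /x -powRrM mulVf ?gt_eqF// powRr1// divr_ge0 ?mulr_ge0 ?ltW//.
have x0 : 0 <= x by exact: powR_ge0.
have x1 : 1 <= x.
  apply: (@le_trans _ _ (1 `^ alpha^-1)); first by rewrite powR1.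
  apply: ge0_ler_powR; rewrite ?nnegrE ?invr_ge0 ?(ltW alpha0)//.
    by rewrite divr_ge0 ?mulr_ge0 ?ltW.
  by rewrite ler_pdivlMr// mul1r.
have xM : x < (M %/ 2).-1%:R.
  have Mp : (M %/ 2).-1%:R = (M%:R - 2) / 2 :> R.
    rewrite M2 -subn1 natrB//.
    by field.
  rewrite Mp ltNge; apply/negP => le_x.
  have : ((M%:R - 2) / 2) `^ alpha <= x `^ alpha.
    by apply: ge0_ler_powR; rewrite ?nnegrE//; lra.
  rewrite xa powRM ?invr_ge0//; last by lra.
  rewrite -[2^-1]powR_inv1// -powRrM mulN1r powRN ler_pdivlMr// mulrAC.
  rewrite ler_pdivrMr ?powR_gt0// => hle.
  move: eps_gt; rewrite ltr_pdivrMr// ltNge => /negP; apply.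
  by rewrite mulrC (le_trans hle)// -mulrA mulrC.
(* Here k0 = n + 2 and the ceiling is n + 1 <= M/2 - 1, so k0 <= M/2 and the corner triangles
   fit. *)
have [n [k0E xn nM]] := ceilD1_nat x1 xM.
rewrite -/x -/k0 in k0E.
have kM := le_half _ nM.
(* The tail at k0 + 1 is at most theta0/(k0-1)^alpha, and k0 - 1 >= x. *)
have ctail_eps : mu * ctail alpha n.+3 <= eps.
  have n1p : 0 < n.+1%:R `^ alpha :> R by rewrite powR_gt0.
  apply: (@le_trans _ _ (mu * (theta0 / n.+1%:R `^ alpha))).
    by rewrite ler_wpM2l ?(ltW mu0)// th0E ctail_le_theta0.
  rewrite mulrA ler_pdivrMr// [eps * _]mulrC -ler_pdivrMr// -xa.
  by apply: ge0_ler_powR; rewrite ?nnegrE// ltW.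
(* Since k0 + 1 <= M/2 + 1, the bound at M/2 + 1 applies, and M/2 + 3/2 <= M - 1/2 for M >= 4. *)
have tail_theta : theta / (M%:R - 1 / 2) `^ alpha <= ctail alpha n.+3.
  apply: le_trans (@ctail_decreasing R alpha n.+3 (M %/ 2).+1 a02 kM).
  apply: (@le_trans _ _ (theta / ((M %/ 2).+1%:R + 1 / 2) `^ alpha)); last first.
    by rewrite thE; apply: ctail_ge_theta => //; exact: leqW.
  have q4 : 4 <= (M %/ 2)%N%:R :> R by rewrite ler_nat.
  have q0 : 0 < (M %/ 2).+1%:R + 1 / 2 :> R by rewrite addr_gt0.
  have m0 : 0 < M%:R - 1 / 2 :> R by lra.
  rewrite ler_wpM2l ?(ltW th_gt0)// lef_pV2 ?posrE ?powR_gt0//.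
  apply: ge0_ler_powR; rewrite ?nnegrE ?(ltW alpha0) ?(ltW q0) ?(ltW m0)//.
  by rewrite -natr1; lra.
have hpow : h `^ alpha = (b - a) `^ alpha / M.+1%:R `^ alpha.
  by rewrite hE powRM ?invr_ge0 ?ltW// -powR_inv1// -powRrM mulN1r powRN.
set L := 2 `^ (alpha + 1) * gamma * tau * theta / (b - a) `^ alpha in den *.
have bap : 0 < (b - a) `^ alpha by rewrite powR_gt0.
have L0 : 0 <= L.
  by rewrite divr_ge0 ?(ltW bap)// !mulr_ge0 ?powR_ge0 ?(ltW g0) ?(ltW tau0) ?(ltW th_gt0).
(* M/2 + 1/2 is (M+1)/2, and its power cancels the factor (M+1)^alpha contained in mu. *)
have LE : L = 2 * mu * (theta / ((M %/ 2)%N%:R + 1 / 2) `^ alpha).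
  have -> : (M %/ 2)%N%:R + 1 / 2 = M.+1%:R / 2 :> R.
    by rewrite -[M.+1%:R]natr1 M2; field.
  rewrite powRM ?invr_ge0// -[2^-1]powR_inv1// -powRrM mulN1r powRN /L muE hpow.
  rewrite powRD; last by apply/implyP => _; rewrite pnatr_eq0.
  rewrite powRr1//; field.
  by rewrite !gt_eqF ?powR_gt0.
have coercive (y : 'cV[R]_M) : L * sqnorm y <= cdot y (strangC alpha mu M *m y).
  apply: le_trans (strangC_coercive y a02 (ltW mu0) Meven M_ge2).
  rewrite ler_wpM2r ?sqnorm_ge0// LE ler_wpM2l ?mulr_ge0 ?(ltW mu0)//.
  by rewrite thE; exact: ctail_ge_theta.
have symC := strangC_tr alpha mu Meven.
have wL : 0 <= omega + L by rewrite addr_ge0 ?(ltW w0).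
have uC : omega%:M + calH (strangC alpha mu M) \in unitmx by exact: unitmx_calH coercive _.
have uB := calB_unitmx dD D0 w0.
pose B0 := corner alpha mu M n.+2.
pose B1 := toepT alpha mu M - strangC alpha mu M - B0.
pose V := invmx (omega%:M + calH (strangC alpha mu M)).
exists (V *m block_mx B0 0 0 B0), (V *m block_mx B1 0 0 B1); split.
(* The invertible factor preserves rank; two diagonal copies of rank 2 k0 give 4 k0. *)
- rewrite eqmxMfull; last by rewrite row_full_unit unitmx_inv.
  rewrite rank_diag_block_mx mxrank_corner//.
  by rewrite k0E four.
- pose r := mu * (coef alpha 0 / 2 - theta / (M%:R - 1 / 2) `^ alpha).
  apply: le_trans (specnorm_invmx_calH (r := r) _ symC coercive wL _ _) _.
  + by [].
  + rewrite mulr_ge0 ?(ltW mu0)// subr_ge0 (le_trans tail_theta)// -ctail1//.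
    exact: ctail_decreasing.
  + move=> i; apply: le_trans (corner_rowsum i a02 (ltW mu0) Meven kM) _.
    by rewrite ler_wpM2l ?(ltW mu0)// lerD2l lerN2.
  + by rewrite le_eqVlt; apply/orP; left; apply/eqP; rewrite /r /den; ring.
- apply: specnorm_invmx_calH => //.
    exact: ltW.
  by move=> i; apply: le_trans (corner_compl_rowsum i a02 (ltW mu0) Meven kM) _.
(* Part of the claim because [invmx] returns a singular matrix unchanged. *)
- by apply: calF_unitmx => //; rewrite gt_eqF.
- rewrite invmx_calF//; last by rewrite gt_eqF.
  have B01 : B0 + B1 = toepT alpha mu M - strangC alpha mu M.
    by rewrite /B1 addrC subrK.
  by rewrite calHB -addrA -mulmxDr add_block_mx !addr0 B01.
Qed.
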